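(* Let $R$ be a commutative ring with unit, let $X$ be a simplicial set, and let $m,n\ge 0$ be integers. Consider the degree-$n$ homomorphism $h_n = AW\,(t\,SHI)^n : C_m^{N}(X\times X)\to \big(C_*^{N}(X)\otimes C_*^{N}(X)\big)_{m+n}$. For $a,b\in X_m$ the following holds. If $n$ is even, then $$AW(t\,SHI)^n(a\times b)=\sum_{i_n=n}^{m}\ \sum_{i_{n-1}=n-1}^{i_n-1}\cdots\sum_{i_0=0}^{i_1-1}(-1)^{A(n)+B(n,m,\bar\imath)+C(n,\bar\imath)+D(n,m,\bar\imath)}$$ $$\partial_{i_0+1}\cdots\partial_{i_1-1}\,\partial_{i_2+1}\cdots\cdots\partial_{i_{n-1}-1}\,\partial_{i_n+1}\cdots\partial_m\,a\ \otimes\ \partial_0\cdots\partial_{i_0-1}\,\partial_{i_1+1}\cdots\cdots\partial_{i_{n-2}-1}\,\partial_{i_{n-1}+1}\cdots\partial_{i_n-1}\,b .$$ If $n$ is odd, then $$AW(t\,SHI)^n(a\times b)=\sum_{i_n=n}^{m}\ \sum_{i_{n-1}=n-1}^{i_n-1}\cdots\sum_{i_0=0}^{i_1-1}(-1)^{A(n)+B(n,m,\bar\imath)+C(n,\bar\imath)+D(n,m,\bar\imath)}$$ $$\partial_{i_0+1}\cdots\partial_{i_1-1}\,\partial_{i_2+1}\cdots\cdots\partial_{i_{n-2}-1}\,\partial_{i_{n-1}+1}\cdots\partial_{i_n-1}\,b\ \otimes\ \partial_0\cdots\partial_{i_0-1}\,\partial_{i_1+1}\cdots\cdots\partial_{i_{n-1}-1}\,\partial_{i_n+1}\cdots\partial_m\,a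 .$$ Here $\bar\imath=(i_0,i_1,\dots,i_n)$ and $$A(n)=\begin{cases}1,& n\equiv 3,4,5,6 \bmod 8,\\ 0,&\text{otherwise,}\end{cases}$$ $$B(n,m,\bar\imath)=\begin{cases}\displaystyle\sum_{j=0}^{\lfloor n/2\rfloor} i_{2j}, & n\equiv 1,2 \bmod 4,\\[2mm] \displaystyle\sum_{j=0}^{\lfloor (n-1)/2\rfloor} i_{2j+1}+nm, & n\equiv 0,3\bmod 4,\end{cases}$$ $$C(n,\bar\imath)=\sum_{j=1}^{\lfloor n/2\rfloor}(i_{2j}+i_{2j-1})(i_{2j-1}+\cdots+i_0),$$ $$D(n,m,\bar\imath)=\begin{cases}(m+i_n)(i_n+\cdots+i_0), & n\text{ odd},\\ 0,& n\text{ even}.\end{cases}$$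
   Context: For a simplicial set $X$ with face operators $\partial_i$ and degeneracy operators $s_i$, $C_*^{N}(X)$ is the normalized chain complex of $X$ with coefficients in $R$: the free $R$-module on simplices modulo the submodule generated by degenerate simplices, with differential $\sum_i(-1)^i\partial_i$. A simplex of $X\times Y$ of dimension $m$ is written $a\times b$ with $a\in X_m$, $b\in Y_m$. Operators compose from right to left. A $(p,q)$-shuffle $(\alpha,\beta)$ is a partition of $\{0,\dots,p+q-1\}$ into $\alpha_1<\dots<\alpha_p$ and $\beta_1<\dots<\beta_q$; $sig(\alpha,\beta)=\sum_{i=1}^{p}(\alpha_i-(i-1))$. The Alexander-Whitney operator $AW:C_*^{N}(X\times Y)\to C_*^{N}(X)\otimes C_*^{N}(Y)$ is $$AW(a_m\times b_m)=\sum_{i=0}^m\partial_{i+1}\cdots\partial_m a_m\otimes\partial_0\cdots\partial_{i-1}b_m .$$ The Shih operator $SHI:C_*^{N}(X\times Y)\to C_{*+1}^{N}(X\times Y)$ is $SHI(a_0\times b_0)=0$ and, for $m\ge1$, $$SHI(a_m\times b_m)=\sum(-1)^{\bar m+sig(\alpha,\beta)+1}\ s_{\beta_q+\bar m}\cdots s_{\beta_1+\bar m}s_{\bar m-1}\partial_{m-q+1}\cdots\partial_m a_m\times s_{\alpha_{p+1}+\bar m}\cdots s_{\alpha_1+\bar m}\partial_{\bar m}\cdots\partial_{m-q-1}b_m,$$ where $\bar m=m-p-q$, $sig(\alpha,\beta)=\sum_{i=1}^{p+1}(\alpha_i-(i-1))$, and the sum is over $0\le q\le m-1$, $0\le p\le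 m-q-1$ and all $(p+1,q)$-shuffles $(\alpha,\beta)$. The map $t:C_*^{N}(X\times X)\to C_*^{N}(X\times X)$ is $t(x_1\times x_2)=x_2\times x_1$. Convention on face strings: a block $\partial_r\cdots\partial_s$ denotes the composition $\partial_r\partial_{r+1}\cdots\partial_s$, and is empty (identity) if $r>s$. For $n$ even, the first factor of each summand is the composition, in increasing order of index, of all $\partial_k$ with $i_{2l}<k<i_{2l+1}$ for some $0\le l\le n/2-1$ or $i_n<k\le m$; the second factor uses all $\partial_k$ with $0\le k<i_0$ or $i_{2l-1}<k<i_{2l}$ for some $1\le l\le n/2$. For $n$ odd, the first factor uses all $\partial_k$ with $i_{2l}<k<i_{2l+1}$ for some $0\le l\le (n-1)/2$; the second uses all $\partial_k$ with $0\le k<i_0$, or $i_{2l-1}<k<i_{2l}$ for some $1\le l\le (n-1)/2$, or $i_n<k\le m$. Empty sums are $0$ (for $n=0$ the only summation is over $0\le i_0\le m$). *)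

(* Defs.v *)
From HB Require Import structures.
From mathcomp Require Import all_boot all_order all_algebra.
From mathcomp Require Import generic_quotient ring_quotient.
From mathcomp Require Import boolp.
From mathcomp Require Import finmap.
From mathcomp Require Import xfinmap monalg.
From mathcomp Require Import zify.

Set Implicit Arguments.
Unset Strict Implicit.
Unset Printing Implicit Defensive.

Import GRing.Theory.
Local Open Scope ring_scope.
Local Open Scope quotient_scope.

(* The module structure that monalg puts on [{malg R[K]}] needs [1 != 0] in  *)
(* [R]; the alias [freemod R K] carries one for every commutative ring.         *)
Definition freemod (R : comPzRingType) (K : choiceType) := {malg R[K]}.

HB.instance Definition _ (R : comPzRingType) (K : choiceType) :=
  GRing.Zmodule.on (freemod R K).

Section FreeModule.
Variables (R : comPzRingType) (K : choiceType).
Implicit Types (g : freemod R K) (c : R).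

Definition freemod_scale c g : freemod R K := [malg k in msupp g => c * g@_k].

Lemma freemod_scaleE c g k : (freemod_scale c g)@_k = c * g@_k.
Proof. by rewrite mcoeffE; case: msuppP => // _; rewrite mulr0. Qed.

Let freemod_scaleA c c' g : freemod_scale c (freemod_scale c' g) = freemod_scale (c * c') g.
Proof. by apply/malgP=> k; rewrite !freemod_scaleE mulrA. Qed.

Let freemod_scale1 : left_id 1 freemod_scale.
Proof. by move=> g; apply/malgP=> k; rewrite freemod_scaleE mul1r. Qed.

Let freemod_scaleDr : right_distributive freemod_scale +%R.
Proof.
by move=> c g h; apply/malgP=> k; rewrite mcoeffD !freemod_scaleE mcoeffD mulrDr.
Qed.

Let freemod_scaleDl g : {morph freemod_scale^~ g : c c' / c + c'}.
Proof. by move=> c c'; apply/malgP=> k; rewrite mcoeffD !freemod_scaleE mulrDl. Qed.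

HB.instance Definition _ := GRing.Zmodule_isLmodule.Build R (freemod R K)
  freemod_scaleA freemod_scale1 freemod_scaleDr freemod_scaleDl.

Definition gen (k : K) : freemod R K := mkmalgU k 1.

Variables (M : lmodType R) (f : K -> M).

Definition freemod_lift g : M := \sum_(k <- msupp g) g@_k *: f k.

Lemma freemod_liftEw (D : {fset K}) g : (msupp g `<=` D)%fset ->
  freemod_lift g = \sum_(k <- D) g@_k *: f k.
Proof.
move=> le; rewrite /freemod_lift; apply: big_fset_incl => // k _ kg.
by rewrite mcoeff_outdom // scale0r.
Qed.

Lemma freemod_lift_is_linear : linear freemod_lift.
Proof.
move=> c g h.
pose D := (msupp g `|` msupp h `|` msupp (c *: g + h))%fset.
have le_D x : x \in [:: g; h; c *: g + h] -> (msupp x `<=` D)%fset.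
  rewrite !inE => /or3P[] /eqP->; apply/fsubsetP=> k;
  by rewrite /D !in_fsetU => ->; rewrite ?orbT.
rewrite !(@freemod_liftEw D) ?le_D ?inE ?eqxx ?orbT //.
rewrite scaler_sumr -big_split /=; apply: eq_bigr => k _.
by rewrite mcoeffD freemod_scaleE scalerDl scalerA.
Qed.

HB.instance Definition _ :=
  GRing.isLinear.Build R (freemod R K) M *:%R freemod_lift freemod_lift_is_linear.

Lemma freemod_lift_gen k : freemod_lift (gen k) = f k.
Proof.
rewrite (@freemod_liftEw [fset k]%fset) ?msuppU_le //.
by rewrite big_seq_fset1 mcoeffUU scale1r.
Qed.

End FreeModule.

Section QuotientModule.
Variables (R : comPzRingType) (V : lmodType R).

Definition gspan (G : V -> Prop) : {pred V} :=
  fun v => `[< forall S : submodClosed V,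
                 (forall g, G g -> g \in S) -> v \in S >].

Lemma gspanP (G : V -> Prop) v :
  v \in gspan G <->
  (forall S : submodClosed V, (forall g, G g -> g \in S) -> v \in S).
Proof. by rewrite unfold_in; split => [/asboolP|?]; last apply/asboolP. Qed.

Lemma mem_gspan (G : V -> Prop) g : G g -> g \in gspan G.
Proof. by move=> Gg; apply/gspanP=> S; apply. Qed.

Lemma gspan_submod_closed (G : V -> Prop) : submod_closed (gspan G).
Proof.
split=> [|c u v /gspanP su /gspanP sv]; apply/gspanP=> S GS; first exact: rpred0.
by rewrite rpredD ?rpredZ // ?su ?sv.
Qed.

HB.instance Definition _ G :=
  GRing.isSubmodClosed.Build R V (gspan G) (gspan_submod_closed G).

(* the quotient of [V] by the submodule generated by [G] *)
Definition quotm (G : V -> Prop) := Quotient.quot (gspan G).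

Variable G : V -> Prop.

HB.instance Definition _ := Choice.on (quotm G).
HB.instance Definition _ := GRing.Zmodule.on (quotm G).

Definition qproj (v : V) : quotm G := \pi_(Quotient.quot (gspan G)) v.

Lemma qproj_eq u v : (qproj u = qproj v) <-> u - v \in gspan G.
Proof. by rewrite /qproj Quotient.idealrBE; split=> /eqP. Qed.

Lemma qprojK (x : quotm G) : qproj (repr (x : Quotient.quot (gspan G))) = x.
Proof. exact: reprK. Qed.

Let qprojD u v : qproj (u + v) = qproj u + qproj v.
Proof. exact: raddfD. Qed.

Definition quotm_scale (c : R) (x : quotm G) : quotm G :=
  qproj (c *: repr (x : Quotient.quot (gspan G))).

Lemma qproj_scale c v : qproj (c *: v) = quotm_scale c (qproj v).
Proof.
by apply/qproj_eq; rewrite -scalerBr rpredZ //; apply/qproj_eq; rewrite qprojK.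
Qed.

Let quotm_scaleA c c' x :
  quotm_scale c (quotm_scale c' x) = quotm_scale (c * c') x.
Proof. by rewrite -(qprojK x) -!qproj_scale scalerA. Qed.

Let quotm_scale1 : left_id 1 quotm_scale.
Proof. by move=> x; rewrite -(qprojK x) -!qproj_scale scale1r. Qed.

Let quotm_scaleDr : right_distributive quotm_scale +%R.
Proof.
move=> c x y; rewrite -(qprojK x) -(qprojK y) -!qproj_scale -!qprojD -qproj_scale.
by rewrite scalerDr.
Qed.

Let quotm_scaleDl x : {morph quotm_scale^~ x : c c' / c + c'}.
Proof.
by move=> c c'; rewrite -(qprojK x) -!qproj_scale -qprojD scalerDl.
Qed.

HB.instance Definition _ := GRing.Zmodule_isLmodule.Build R (quotm G)
  quotm_scaleA quotm_scale1 quotm_scaleDr quotm_scaleDl.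

Lemma qproj_is_linear : linear qproj.
Proof. by move=> c u v; rewrite qprojD qproj_scale. Qed.

HB.instance Definition _ :=
  GRing.isLinear.Build R V (quotm G) *:%R qproj qproj_is_linear.

End QuotientModule.

Section QuotientLift.
Variables (R : comPzRingType) (V W : lmodType R) (G : V -> Prop).
Variables (f : {linear V -> W}) (f0 : forall g, G g -> f g = 0).

Lemma gspan_ker v : v \in gspan G -> f v = 0.
Proof.
pose K : {pred V} := fun u => f u == 0.
have K_closed : submod_closed K.
  split=> [|c u w]; rewrite !unfold_in ?linear0 // => /eqP fu /eqP fw.
  by rewrite linearP fu fw scaler0 addr0.
pose Kmod := GRing.isSubmodClosed.Build R V K K_closed.
pose KS : submodClosed V := HB.pack K Kmod.
by move/gspanP/(_ KS) => kv; apply/eqP/kv => g /f0/eqP.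
Qed.

Definition quotm_lift (_ : forall g, G g -> f g = 0) (x : quotm G) : W :=
  f (repr (x : Quotient.quot (gspan G))).

Local Notation lift := (quotm_lift f0).

Lemma quotm_liftE v : lift (qproj G v) = f v.
Proof.
by apply/eqP; rewrite -subr_eq0 -linearB; apply/eqP/gspan_ker/qproj_eq; rewrite qprojK.
Qed.

Lemma quotm_lift_is_linear : linear lift.
Proof.
by move=> c x y; rewrite -(qprojK x) -(qprojK y) -linearP !quotm_liftE linearP.
Qed.

HB.instance Definition _ :=
  GRing.isLinear.Build R (quotm G) W *:%R lift quotm_lift_is_linear.

End QuotientLift.

Section Tensor.
Variables (R : comPzRingType) (M N : lmodType R).

Local Notation "x '*b' y" := (@gen R (M * N)%type (x, y)) (at level 40).

Variant bilinear_rel : freemod R (M * N)%type -> Prop :=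
| BilinDl x x' y : bilinear_rel ((x + x') *b y - x *b y - x' *b y)
| BilinDr x y y' : bilinear_rel (x *b (y + y') - x *b y - x *b y')
| BilinZl c x y : bilinear_rel ((c *: x) *b y - c *: (x *b y))
| BilinZr c x y : bilinear_rel (x *b (c *: y) - c *: (x *b y)).

Definition tensor := quotm bilinear_rel.

HB.instance Definition _ := GRing.Lmodule.on tensor.

Definition tens (x : M) (y : N) : tensor := qproj bilinear_rel (x *b y).

Lemma tensDl x x' y : tens (x + x') y = tens x y + tens x' y.
Proof.
rewrite /tens -linearD; apply/qproj_eq; rewrite opprD addrA.
by apply: mem_gspan; exact: BilinDl.
Qed.

Lemma tensDr x y y' : tens x (y + y') = tens x y + tens x y'.
Proof.
rewrite /tens -linearD; apply/qproj_eq; rewrite opprD addrA.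
by apply: mem_gspan; exact: BilinDr.
Qed.

Lemma tensZl c x y : tens (c *: x) y = c *: tens x y.
Proof.
by rewrite /tens -linearZ; apply/qproj_eq; apply: mem_gspan; exact: BilinZl.
Qed.

Lemma tensZr c x y : tens x (c *: y) = c *: tens x y.
Proof.
by rewrite /tens -linearZ; apply/qproj_eq; apply: mem_gspan; exact: BilinZr.
Qed.

Lemma tens0l y : tens 0 y = 0.
Proof. by rewrite -(scale0r 0) tensZl scale0r. Qed.

Lemma tens0r x : tens x 0 = 0.
Proof. by rewrite -(scale0r 0) tensZr scale0r. Qed.

End Tensor.

(* [delta n m] is the set of nondecreasing maps [{0..n} -> {0..m}], that is, *)
(* of morphisms [n] -> [m] in the simplex category.                          *)
Record delta (n m : nat) := Delta {
  delta_fun :> {ffun 'I_n.+1 -> 'I_m.+1};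
  _ : [forall i : 'I_n.+1, forall j : 'I_n.+1,
         (i <= j)%N ==> (delta_fun i <= delta_fun j)%N] }.

HB.instance Definition _ n m := [isSub for @delta_fun n m].

Lemma delta_mono n m (f : delta n m) (i j : 'I_n.+1) :
  (i <= j)%N -> (f i <= f j)%N.
Proof. by case: f => f /= /forallP/(_ i)/forallP/(_ j)/implyP; apply. Qed.

Lemma deltaP n m (f g : delta n m) : (forall i, f i = g i :> nat) -> f = g.
Proof. by move=> fg; apply/val_inj/ffunP => i; apply/val_inj/fg. Qed.

Fact mk_delta_subproof n m (f : 'I_n.+1 -> 'I_m.+1) :
    (forall i j : 'I_n.+1, (i <= j)%N -> (f i <= f j)%N) ->
  [forall i : 'I_n.+1, forall j : 'I_n.+1,
     (i <= j)%N ==> ([ffun k => f k] i <= [ffun k => f k] j)%N].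
Proof.
by move=> fm; apply/forallP=> i; apply/forallP=> j; apply/implyP; rewrite !ffunE; apply: fm.
Qed.

Definition mk_delta n m (f : 'I_n.+1 -> 'I_m.+1) fm : delta n m :=
  Delta (@mk_delta_subproof n m f fm).

Definition delta_id n : delta n n := @mk_delta n n id (fun i j => id).

Definition delta_comp l m n (f : delta m n) (g : delta l m) : delta l n :=
  @mk_delta l n (fun i => f (g i)) (fun i j ij => delta_mono f (delta_mono g ij)).

Fact lift_mono n (i : 'I_n.+2) (j k : 'I_n.+1) :
  (j <= k)%N -> (lift i j <= lift i k)%N.
Proof. by rewrite /= leq_bump2. Qed.

Definition coface n (i : 'I_n.+2) : delta n n.+1 := mk_delta (@lift_mono n i).

Fact unbump_bound n (i : 'I_n.+1) (j : 'I_n.+2) : (unbump i j < n.+1)%N.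
Proof.
rewrite /unbump; have := ltn_ord i; have := ltn_ord j.
by case: ltnP => [ij|ji] jn iin /=; lia.
Qed.

Definition collapse n (i : 'I_n.+1) (j : 'I_n.+2) : 'I_n.+1 :=
  Ordinal (unbump_bound i j).

Fact collapse_mono n (i : 'I_n.+1) (j k : 'I_n.+2) :
  (j <= k)%N -> (collapse i j <= collapse i k)%N.
Proof. by rewrite /= /unbump => jk; do 2!case: ltnP => /= ?; lia. Qed.

Definition codegeneracy n (i : 'I_n.+1) : delta n.+1 n :=
  mk_delta (@collapse_mono n i).

Record sset := SSet {
  sset_obj :> nat -> Type;
  sset_map : forall m n, delta n m -> sset_obj m -> sset_obj n;
  sset_map_id : forall m x, sset_map (delta_id m) x = x;
  sset_map_comp : forall l m n (f : delta m l) (g : delta n m) x,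
    sset_map (delta_comp f g) x = sset_map g (sset_map f x) }.

Arguments sset_map {s m n} _ _.

Definition face (X : sset) m (i : 'I_m.+2) : X m.+1 -> X m :=
  sset_map (coface i).

Definition degen (X : sset) m (i : 'I_m.+1) : X m -> X m.+1 :=
  sset_map (codegeneracy i).

Definition prod_sset (X Y : sset) : sset.
Proof.
apply: (@SSet (fun m => X m * Y m)%type
  (fun m n f xy => (sset_map f xy.1, sset_map f xy.2))).
- by move=> m [x y]; rewrite !sset_map_id.
- by move=> l m n f g [x y]; rewrite !sset_map_comp.
Defined.

(* Simplices of all dimensions; [tag] is the dimension. *)
Definition simplex (X : sset) := {m : nat & X m}.

HB.instance Definition _ X := gen_eqMixin (simplex X).
HB.instance Definition _ X := gen_choiceMixin (simplex X).

Definition Simplex (X : sset) m (x : X m) : simplex X := Tagged X x.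

(* The operators [d_i] and [s_i] on simplices of all dimensions. The values  *)
(* for [i] out of range, and for faces of vertices, are never used.          *)
Definition fc (X : sset) (i : nat) (u : simplex X) : simplex X :=
  match u with
  | existT 0 _ => u
  | existT m.+1 x => Simplex (face (inord i) x)
  end.

Definition dg (X : sset) (i : nat) (u : simplex X) : simplex X :=
  Simplex (degen (inord i) (tagged u)).

(* [faces [:: i_1; ..; i_k] u] is [d_{i_1} ... d_{i_k} u]: operators compose *)
(* from right to left, and the head of the list is applied last.             *)
Definition faces (X : sset) (l : seq nat) (u : simplex X) := foldr (@fc X) u l.
Definition degens (X : sset) (l : seq nat) (u : simplex X) := foldr (@dg X) u l.

Definition degenerate (X : sset) (u : simplex X) : Prop :=
  exists m (i : 'I_m.+1) (x : X m), u = Simplex (degen i x).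

Section Product.
Variables X Y : sset.

Definition fstS (u : simplex (prod_sset X Y)) : simplex X :=
  Simplex (tagged u).1.
Definition sndS (u : simplex (prod_sset X Y)) : simplex Y :=
  Simplex (tagged u).2.

End Product.

Section Chains.
Variables (R : comPzRingType) (X : sset).

Variant degenerate_rel : freemod R (simplex X) -> Prop :=
| DegenerateRel u of degenerate u : degenerate_rel (gen R u).

(* The graded module of normalized chains, as the direct sum of its         *)
(* homogeneous components: it is spanned by simplices of all dimensions.     *)
(* [chain_degree] below is the component of degree [m].                      *)
Definition chains := quotm degenerate_rel.

HB.instance Definition _ := GRing.Lmodule.on chains.

Definition cls (u : simplex X) : chains := qproj degenerate_rel (gen R u).

Lemma cls_degenerate u : degenerate u -> cls u = 0.
Proof.
move=> du; rewrite -(linear0 (qproj degenerate_rel)); apply/qproj_eq.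
by rewrite subr0 mem_gspan.
Qed.

Variables (M : lmodType R) (f : simplex X -> M).
Hypothesis f0 : forall u, degenerate u -> f u = 0.

Let free_f0 g : degenerate_rel g -> freemod_lift f g = 0.
Proof. by case=> u /f0; rewrite freemod_lift_gen. Qed.

Definition chain_lift : chains -> M := quotm_lift free_f0.

HB.instance Definition _ := GRing.Linear.on chain_lift.

Lemma chain_liftE u : chain_lift (cls u) = f u.
Proof. by rewrite /chain_lift quotm_liftE; apply: freemod_lift_gen. Qed.

End Chains.

(* The class of [a x b], for [a] and [b] of the same dimension. The other    *)
(* branch is never taken: see [crossE], [tag_SHI_fst] and [tag_SHI_snd].     *)
Definition cross (R : comPzRingType) (X Y : sset)
    (a : simplex X) (b : simplex Y) : chains R (prod_sset X Y) :=
  if tag b =P tag a is ReflectT e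
  then cls R (@Simplex (prod_sset X Y) (tag a) (tagged a, etagged e))
  else 0.

Definition AW_term (R : comPzRingType) (X Y : sset)
    (u : simplex (prod_sset X Y)) : tensor (chains R X) (chains R Y) :=
  let m := tag u in
  \sum_(i < m.+1)
    tens (cls R (faces (index_iota i.+1 m.+1) (fstS u)))
         (cls R (faces (index_iota 0 i) (sndS u))).

(* A (p,q)-shuffle is given by [alpha], a subset of [{0..p+q-1}] with [p]    *)
(* elements; [beta] is its complement, and [elts] lists in increasing order. *)
Definition elts N (A : {set 'I_N}) : seq nat := [seq val i | i <- enum A].

Definition shuffle_sig (l : seq nat) : nat :=
  (\sum_(i < size l) (nth 0 l i - i))%N.

Definition SHI_fst (X : sset) (m p q : nat) (A : {set 'I_(p.+1 + q)})
    (a : simplex X) : simplex X :=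
  let mb := (m - p - q)%N in
  let beta := elts (~: A) in
  degens (rcons (rev [seq (i + mb)%N | i <- beta]) mb.-1)
    (faces (index_iota (m - q).+1 m.+1) a).

Definition SHI_snd (Y : sset) (m p q : nat) (A : {set 'I_(p.+1 + q)})
    (b : simplex Y) : simplex Y :=
  let mb := (m - p - q)%N in
  let alpha := elts A in
  degens (rev [seq (i + mb)%N | i <- alpha])
    (faces (index_iota mb (m - q)) b).

Definition SHI_term (R : comPzRingType) (X Y : sset)
    (u : simplex (prod_sset X Y)) : chains R (prod_sset X Y) :=
  let m := tag u in
  \sum_(q < m) \sum_(p < m - q)
    \sum_(A : {set 'I_(p.+1 + q)} | #|A| == p.+1)
      (-1) ^+ ((m - p - q) + shuffle_sig (elts A) + 1)%N *:
        cross R (SHI_fst m A (fstS u)) (SHI_snd m A (sndS u)).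

Definition swap (X : sset) (u : simplex (prod_sset X X)) :
    simplex (prod_sset X X) :=
  @Simplex (prod_sset X X) (tag u) ((tagged u).2, (tagged u).1).

(* [operates f u v]: [v] is obtained from [u] by the simplicial operator of  *)
(* the nondecreasing map [f].                                                *)
Definition operates (X : sset) (f : nat -> nat) (u v : simplex X) : Prop :=
  exists th : delta (tag v) (tag u),
    (forall i, th i = f i :> nat) /\ tagged v = sset_map th (tagged u).

Section Operates.
Variable X : sset.
Implicit Types (u v w : simplex X).

Lemma operates_id u : operates id u u.
Proof.
exists (delta_id (tag u)); rewrite sset_map_id; split=> // i.
by rewrite ffunE.
Qed.

Lemma operates_comp f g u v w :
  operates f u v -> operates g v w -> operates (f \o g) u w.
Proof.
move=> [th [thE vE]] [et [etE wE]]; exists (delta_comp th et).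
rewrite sset_map_comp wE vE; split=> // i.
by rewrite ffunE thE /= etE.
Qed.

Lemma operates_eq f g u v : operates f u v ->
  (forall i, (i <= tag v)%N -> f i = g i) -> operates g u v.
Proof.
move=> [th [thE vE]] fg; exists th; split=> // i.
by rewrite thE fg // -ltnS ltn_ord.
Qed.

Lemma tag_fc i u : tag (fc i u) = (tag u).-1.
Proof. by case: u => [[|m] x]. Qed.

Lemma tag_faces l u : tag (faces l u) = (tag u - size l)%N.
Proof. by elim: l => [|i l IH] /=; rewrite ?subn0 // tag_fc IH subnS. Qed.

Lemma tag_degens l u : tag (degens l u) = (tag u + size l)%N.
Proof. by elim: l => [|i l IH] /=; rewrite ?addn0 // IH addnS. Qed.

Lemma operates_fc i u : (0 < tag u)%N -> (i <= tag u)%N ->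
  operates (bump i) u (fc i u).
Proof.
case: u => [[|m] x] //= _ im; exists (coface (inord i)); split=> // j.
by rewrite ffunE /= inordK.
Qed.

Lemma operates_dg i u : (i <= tag u)%N -> operates (unbump i) u (dg i u).
Proof.
case: u => [m x] /= im; exists (codegeneracy (inord i)); split=> // j.
by rewrite ffunE /= inordK.
Qed.

Lemma operates_faces r k u : (k <= tag u)%N -> (r + k <= (tag u).+1)%N ->
  operates (fun x => if (x < r)%N then x else (x + k)%N) u
           (faces (iota r k) u).
Proof.
elim: k r => [|k IH] r km rkm /=.
  by apply: operates_eq (operates_id u) _ => i _; rewrite addn0 if_same.
have IHr := IH r.+1 (ltnW km) _; rewrite addSnnS in IHr.
apply: operates_eq (operates_comp (IHr rkm) (operates_fc _ _)) _.
- by rewrite tag_faces size_iota subn_gt0.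
- by rewrite tag_faces size_iota; lia.
- by move=> i _ /=; rewrite /bump; case: (leqP r i) => /= ?; case: ltnP; lia.
Qed.

Lemma operates_degens l u : sorted ltn l -> all (gtn (tag u + size l)%N) l ->
  operates (fun x => x - count (gtn x) l)%N u (degens (rev l) u).
Proof.
elim/last_ind: l => [|l i IH] sl.
  by move=> _; apply: operates_eq (operates_id u) _ => i _; rewrite subn0.
rewrite all_rcons size_rcons rev_rcons addnS /= => /andP[im lm].
have li : all (gtn i) l.
  by move: sl; rewrite (sorted_pairwise ltn_trans) -cats1 pairwise_cat allrel1r => /and3P[].
have {}sl : sorted ltn l by move: sl; rewrite -cats1 => /cat_sorted2[].
have {}IH : operates (fun x => x - count (gtn x) l)%N u (degens (rev l) u).
  apply: IH => //; apply/allP => j jl.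
  by have /= := allP li j jl; have /= := im; lia.
apply: operates_eq (operates_comp IH (operates_dg _)) _.
  by rewrite tag_degens size_rev; move: im => /=; lia.
move=> x _ /=; rewrite -cats1 count_cat /= addn0 /unbump.
case: (ltnP i x) => ix; rewrite ?subn0 ?addn0 //.
have cE y : (i <= y)%N -> count (gtn y) l = size l.
  by move=> iy; apply/eqP; rewrite -all_count; apply/allP => j /(allP li) /= ji; lia.
by rewrite !cE; lia.
Qed.

Lemma operates_collapse f u m (x : X m.+1) j :
  operates f u (Simplex x) -> (j <= m)%N -> f j = f j.+1 ->
  x = degen (inord j) (face (inord j) x).
Proof.
case=> th [/= thE xE] jm fj; rewrite /degen /face xE -!sset_map_comp.
congr (sset_map _ _); apply: deltaP => i; rewrite !ffunE !thE /= !inordK ?ltnS ?(leqW jm) //.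
rewrite /bump /unbump; have [->|ij] := eqVneq (i : nat) j.
  by rewrite ltnn subn0 leqnn.
by congr f; case: (ltnP j i) => ji; case: leqP => /=; lia.
Qed.

Lemma operates_degenerate f u v j : operates f u v -> (j < tag v)%N ->
  f j = f j.+1 -> degenerate v.
Proof.
case: v => [[|m] x] //= fuv jm fj.
by exists m, (inord j), (face (inord j) x); rewrite -(operates_collapse fuv).
Qed.

Lemma operates_degen m (i : 'I_m.+1) (x : X m) :
  operates (unbump i) (Simplex x) (Simplex (degen i x)).
Proof. by exists (codegeneracy i); split=> // k; rewrite ffunE. Qed.

End Operates.

Lemma crossE (R : comPzRingType) (X Y : sset) m (x : X m) (y : Y m) :
  cross R (Simplex x) (Simplex y) = cls R (@Simplex (prod_sset X Y) m (x, y)).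
Proof.
by rewrite /cross; case: eqP => //= e; rewrite (eq_irrelevance e erefl).
Qed.

Lemma cross_degenerate (R : comPzRingType) (X Y : sset) f g
    (u a : simplex X) (v b : simplex Y) j :
    operates f u a -> operates g v b -> tag a = tag b -> (j < tag a)%N ->
    f j = f j.+1 -> g j = g j.+1 ->
  cross R a b = 0.
Proof.
case: a b => [m x] [m' y] /= fa gb mm'; case: _ / mm' y gb => y gb.
case: m x y fa gb => [|m] x y fa gb //= jm fj gj.
have xE := operates_collapse fa jm fj; have yE := operates_collapse gb jm gj.
rewrite -/(Simplex x) -/(Simplex y) crossE; apply: cls_degenerate.
exists m, (inord j), (face (inord j) x, face (inord j) y).
by congr Simplex; rewrite /degen /=; congr pair.
Qed.

Section AlexanderWhitney.
Variables (R : comPzRingType) (X Y : sset).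

Lemma AW_term_degenerate (u : simplex (prod_sset X Y)) :
  degenerate u -> AW_term R u = 0.
Proof.
case=> m [i [[x y] ->]]; rewrite /AW_term /=; apply: big1 => -[k /= km] _.
have im := ltn_ord i.
have [ik|ki] := ltnP i k.
  rewrite cls_degenerate ?tens0l // /index_iota subSS.
  have F := @operates_faces _ k.+1 (m.+1 - k)%N (Simplex (degen i x)).
  apply: (operates_degenerate (j := i) (operates_comp (operates_degen i x) (F _ _))).
  - by rewrite /= leq_subr.
  - by rewrite /=; lia.
  - by rewrite tag_faces size_iota /=; lia.
  - by rewrite /= /unbump ltnS (ltnW ik) ltnS ik; lia.
rewrite [X in tens _ X]cls_degenerate ?tens0r // /index_iota subn0.
have F := @operates_faces _ 0 k (Simplex (degen i y)).
apply: (operates_degenerate (j := (i - k)%N) (operates_comp (operates_degen i y) (F _ _))).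
- exact: km.
- exact: leqW.
- by rewrite tag_faces size_iota /=; lia.
- by rewrite /= /unbump addSn subnK // ltnn ltnSn; lia.
Qed.

Definition AW : chains R (prod_sset X Y) -> tensor (chains R X) (chains R Y) :=
  chain_lift AW_term_degenerate.

HB.instance Definition _ := GRing.Linear.on AW.

End AlexanderWhitney.

Section Shuffles.
Variables (N : nat) (A : {set 'I_N}).

Lemma size_elts : size (elts A) = #|A|.
Proof. by rewrite size_map -cardE. Qed.

Lemma elts_sorted : sorted ltn (elts A).
Proof.
apply: (subseq_sorted ltn_trans) (iota_ltn_sorted 0 N).
by rewrite -val_enum_ord map_subseq // enumT filter_subseq.
Qed.

Lemma elts_ltn : all (gtn N) (elts A).
Proof. by apply/allP => _ /mapP[i _ ->] /=. Qed.

Lemma elts_partition : perm_eq (elts A ++ elts (~: A)) (iota 0 N).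
Proof.
rewrite -val_enum_ord -map_cat; apply: perm_map.
have E (B : {set 'I_N}) : enum B = [seq i <- enum 'I_N | i \in B].
  by rewrite enumT.
rewrite !E [X in _ ++ X](@eq_filter _ _ (predC (mem A))) => [|i].
  exact/permPl/perm_filterC.
by rewrite /= in_setC.
Qed.

Lemma count_eltsC y : (y <= N)%N ->
  (count (gtn y) (elts A) + count (gtn y) (elts (~: A)) = y)%N.
Proof.
move=> yN; rewrite -count_cat (permP elts_partition).
have yE : filter (gtn y) (iota 0 N) = iota 0 y by rewrite -[RHS](@filter_iota_ltn 0 N).
by rewrite -size_filter yE size_iota.
Qed.

Lemma count_elts t : (t < #|A|)%N ->
  [/\ (nth 0 (elts A) t < N)%N, count (gtn (nth 0 (elts A) t)) (elts A) = t
    & count (gtn (nth 0 (elts A) t).+1) (elts A) = t.+1].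
Proof.
rewrite -size_elts => tA; have sA := elts_sorted; split.
- exact: (allP elts_ltn) (mem_nth _ _).
- exact: (@Order.POrderTheory.count_lt_nth _ nat).
- rewrite -[RHS](@Order.POrderTheory.count_le_nth _ nat 0%N _ _ sA tA).
  by apply: eq_count => i; rewrite /= ltnS.
Qed.

End Shuffles.

Section Shih.
Variables (m p q : nat) (A : {set 'I_(p.+1 + q)}).
Hypotheses (qm : (q < m)%N) (pmq : (p < m - q)%N) (cardA : #|A| = p.+1).

Let cardAC : #|~: A| = q.
Proof. by have := cardsC A; rewrite card_ord cardA; lia. Qed.

Lemma tag_SHI_fst (X : sset) (a : simplex X) :
  tag a = m -> tag (SHI_fst m A a) = m.+1.
Proof.
move=> am; rewrite tag_degens tag_faces size_rcons size_rev size_map size_elts.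
by rewrite size_iota am cardAC; lia.
Qed.

Lemma tag_SHI_snd (Y : sset) (b : simplex Y) :
  tag b = m -> tag (SHI_snd m A b) = m.+1.
Proof.
move=> bm; rewrite tag_degens tag_faces size_rev size_map size_elts.
by rewrite size_iota bm cardA; lia.
Qed.

Let mb := (m - p - q)%N.

Definition SHI_fst_map x :=
  let y := (x - ((mb.-1 < x) + count (gtn (x - mb)%N) (elts (~: A))))%N in
  if (y < (m - q).+1)%N then y else (y + q)%N.

Definition SHI_snd_map x :=
  let y := (x - count (gtn (x - mb)%N) (elts A))%N in
  if (y < mb)%N then y else (y + p)%N.

Let count_shift x l : count (gtn x) [seq (i + mb)%N | i <- l] = count (gtn (x - mb)%N) l.
Proof. by rewrite count_map; apply: eq_count => i /=; lia. Qed.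

Let sorted_shift l : sorted ltn l -> sorted ltn [seq (i + mb)%N | i <- l].
Proof. by rewrite sorted_map; apply: sub_sorted => i j /=; rewrite ltn_add2r. Qed.

Lemma operates_SHI_fst (X : sset) (a : simplex X) :
  tag a = m -> operates SHI_fst_map a (SHI_fst m A a).
Proof.
move=> am; rewrite /SHI_fst -/mb -rev_cons /index_iota subSS subKn 1?ltnW //.
have F := @operates_faces _ (m - q).+1 q a.
apply: (operates_eq (operates_comp (F _ _) (operates_degens _ _))); rewrite ?am; try lia.
- rewrite /= path_sortedE; last exact: ltn_trans.
  rewrite sorted_shift ?elts_sorted // andbT.
  by apply/allP => _ /mapP[i _ ->] /=; rewrite /mb; lia.
- rewrite tag_faces size_iota am /= size_map size_elts cardAC; apply/andP; split.
    by rewrite /mb; lia.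
  apply/allP => _ /mapP[i /(allP (elts_ltn _)) /= iN ->] /=.
  by move: iN; rewrite /mb; lia.
- by move=> x _; rewrite /SHI_fst_map /= count_shift.
Qed.

Lemma operates_SHI_snd (Y : sset) (b : simplex Y) :
  tag b = m -> operates SHI_snd_map b (SHI_snd m A b).
Proof.
move=> bm; rewrite /SHI_snd -/mb /index_iota.
have -> : (m - q - mb)%N = p by rewrite /mb; lia.
have F := @operates_faces _ mb p b.
apply: (operates_eq (operates_comp (F _ _) (operates_degens _ _))).
- by rewrite bm; lia.
- by rewrite bm /mb; lia.
- exact/sorted_shift/elts_sorted.
- rewrite tag_faces size_iota bm size_map size_elts cardA.
  apply/allP => _ /mapP[i /(allP (elts_ltn _)) /= iN ->] /=.
  by move: iN; rewrite /mb; lia.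
- by move=> x _; rewrite /SHI_snd_map /= count_shift.
Qed.

Let countA0 (B : {set 'I_(p.+1 + q)}) x :
  (x <= mb)%N -> count (gtn (x - mb)%N) (elts B) = 0%N.
Proof.
move=> xm; apply/eqP; rewrite -leqn0 leqNgt -has_count.
by apply/hasPn => k /= _; lia.
Qed.

Let SHI_fst_low x : (x <= mb.-1)%N -> SHI_fst_map x = x.
Proof.
move=> xm; rewrite /SHI_fst_map countA0 ?(leq_trans xm) ?leq_pred //.
by rewrite [(mb.-1 < x)%N]ltnNge xm subn0 ifT //; move: xm; rewrite /mb; lia.
Qed.

Let SHI_snd_low x : (x < mb)%N -> SHI_snd_map x = x.
Proof. by move=> xm; rewrite /SHI_snd_map countA0 ?subn0 ?xm // ltnW. Qed.

Let SHI_fst_high y : (y <= p.+1 + q)%N ->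
  SHI_fst_map (mb + y) = (mb.-1 + count (gtn y) (elts A))%N.
Proof.
move=> yN; have := count_eltsC A yN.
have := count_size (gtn y) (elts A); rewrite size_elts cardA.
rewrite /SHI_fst_map addKn => c1 c2.
have -> : (mb.-1 < mb + y)%N by rewrite /mb; lia.
by rewrite ifT; rewrite /mb; lia.
Qed.

Let SHI_snd_high y : (y <= p.+1 + q)%N ->
  SHI_snd_map (mb + y) = (m - q + count (gtn y) (elts (~: A)))%N.
Proof.
move=> yN; have := count_eltsC A yN; rewrite /SHI_snd_map addKn => c1.
by rewrite ifF; rewrite /mb; lia.
Qed.

Let unbump_step i : unbump i i = unbump i i.+1.
Proof. by rewrite /unbump ltnn ltnSn subn0 subn1. Qed.

(* Some step of the shuffle path stays inside [{i, i+1}] in both factors. *)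
Lemma SHI_collapse i : (i < m)%N -> exists2 j, (j <= m)%N &
  unbump i (SHI_fst_map j) = unbump i (SHI_fst_map j.+1) /\
  unbump i (SHI_snd_map j) = unbump i (SHI_snd_map j.+1).
Proof.
move=> im; have cC := @count_eltsC _ A.
have [i1|i1] := ltnP i mb.-1.
  exists i; first exact: ltnW.
  by rewrite !SHI_fst_low ?SHI_snd_low ?unbump_step //; lia.
have [i2|i2] := ltnP i (m - q).
  have tA : (i - mb.-1 < #|A|)%N by rewrite cardA; move: i1 i2; rewrite /mb; lia.
  have [yN cy cy1] := count_elts tA; set y := nth _ _ _ in yN cy cy1.
  have := cC y (ltnW yN); have := cC y.+1 yN; rewrite cy cy1 => c1 c2.
  exists (mb + y)%N; first by rewrite /mb; lia.
  rewrite -addnS !SHI_fst_high ?SHI_snd_high ?(ltnW yN) // cy cy1 addnS subnKC //.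
  by split=> //; congr (unbump i (_ + _)); lia.
have tA : (i - (m - q) < #|~: A|)%N by rewrite cardAC; lia.
have [yN cy cy1] := count_elts tA; set y := nth _ _ _ in yN cy cy1.
have := cC y (ltnW yN); have := cC y.+1 yN; rewrite cy cy1 => c1 c2.
exists (mb + y)%N; first by rewrite /mb; lia.
rewrite -addnS !SHI_fst_high ?SHI_snd_high ?(ltnW yN) // cy cy1 addnS subnKC //.
by split=> //; congr (unbump i (_ + _)); lia.
Qed.

End Shih.

Section ShihOperator.
Variables (R : comPzRingType) (X Y : sset).

Lemma SHI_term_degenerate (u : simplex (prod_sset X Y)) :
  degenerate u -> SHI_term R u = 0.
Proof.
case=> m [i [[x y] ->]]; rewrite /SHI_term /=.
apply: big1 => -[q /= qm] _; apply: big1 => -[p /= pmq] _.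
apply: big1 => A /eqP cardA.
have [j jm [fj gj]] := SHI_collapse qm pmq cardA (ltn_ord i).
pose a := Simplex (degen i x); pose b := Simplex (degen i y).
have fO := operates_SHI_fst qm pmq cardA (a := a) (erefl _).
have gO := operates_SHI_snd qm pmq cardA (b := b) (erefl _).
have fO' := operates_comp (operates_degen i x) fO.
have gO' := operates_comp (operates_degen i y) gO.
rewrite (cross_degenerate R (j := j) fO' gO') ?scaler0 //.
- by rewrite tag_SHI_fst ?tag_SHI_snd.
- by rewrite tag_SHI_fst.
Qed.

Definition SHI : chains R (prod_sset X Y) -> chains R (prod_sset X Y) :=
  chain_lift SHI_term_degenerate.

HB.instance Definition _ := GRing.Linear.on SHI.

End ShihOperator.

Section Twist.
Variables (R : comPzRingType) (X : sset).

Lemma swap_degenerate (u : simplex (prod_sset X X)) :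
  degenerate u -> cls R (swap u) = 0.
Proof.
case=> m [i [[x y] ->]]; apply: cls_degenerate.
by exists m, i, (y, x).
Qed.

Definition twist : chains R (prod_sset X X) -> chains R (prod_sset X X) :=
  chain_lift swap_degenerate.

HB.instance Definition _ := GRing.Linear.on twist.

Definition AW_tSHI (n : nat) (c : chains R (prod_sset X X)) :
    tensor (chains R X) (chains R X) :=
  AW (iter n (fun c => twist (SHI c)) c).

End Twist.

Section Degree.
Variable R : comPzRingType.

Lemma gspan_linear (V W : lmodType R) (f : {linear V -> W}) G H :
  (forall g, G g -> f g \in gspan H) -> forall v, v \in gspan G -> f v \in gspan H.
Proof.
move=> fGH v.
pose K : {pred V} := fun u => f u \in gspan H.
have K_closed : submod_closed K.
  have KE u : (u \in K) = (f u \in gspan H) by [].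
  split=> [|c u w]; rewrite !KE ?linear0 ?rpred0 // => fu fw.
  by rewrite linearP rpredD ?rpredZ.
pose Kmod := GRing.isSubmodClosed.Build R V K K_closed.
pose KS : submodClosed V := HB.pack K Kmod.
by move/gspanP/(_ KS) => kv; apply: kv => g /fGH.
Qed.

Definition chain_degree (X : sset) (m : nat) : {pred chains R X} :=
  gspan (fun c => exists x : X m, c = cls R (Simplex x)).

Definition tensor_degree (X Y : sset) (m : nat) :
    {pred tensor (chains R X) (chains R Y)} :=
  gspan (fun z => exists (a : simplex X) (b : simplex Y),
    (tag a + tag b)%N = m /\ z = tens (cls R a) (cls R b)).

Arguments chain_degree : clear implicits.
Arguments tensor_degree : clear implicits.

Lemma chain_lift_degree (X : sset) (M : lmodType R) (f : simplex X -> M)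
    (f0 : forall u, degenerate u -> f u = 0) (H : M -> Prop) m c :
    (forall x : X m, f (Simplex x) \in gspan H) ->
  c \in chain_degree X m -> chain_lift f0 c \in gspan H.
Proof.
by move=> fH; apply: gspan_linear => _ [x ->]; rewrite /= chain_liftE.
Qed.

Lemma AW_degree (X Y : sset) m (c : chains R (prod_sset X Y)) :
  c \in chain_degree (prod_sset X Y) m -> AW c \in tensor_degree X Y m.
Proof.
apply: chain_lift_degree => xy; rewrite /AW_term /=; apply: rpred_sum => -[i /= im] _.
apply: mem_gspan; eexists; eexists; split; last reflexivity.
by rewrite !tag_faces !size_iota /=; lia.
Qed.

Lemma SHI_degree (X Y : sset) m (c : chains R (prod_sset X Y)) :
  c \in chain_degree (prod_sset X Y) m ->
  SHI c \in chain_degree (prod_sset X Y) m.+1.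
Proof.
apply: chain_lift_degree => xy; rewrite /SHI_term /=; apply: rpred_sum => -[q /= qm] _; apply: rpred_sum => -[p /= pmq] _.
apply: rpred_sum => A /eqP cardA; apply: rpredZ.
have := @tag_SHI_fst _ _ _ A qm pmq cardA _ (fstS (Simplex xy)) (erefl _).
have := @tag_SHI_snd _ _ _ A qm pmq cardA _ (sndS (Simplex xy)) (erefl _).
move: (SHI_fst _ _ _) (SHI_snd _ _ _) => [ka x] [kb y] /= kbm kam.
case: _ / (esym kbm) y => y; case: _ / (esym kam) x => x.
by rewrite crossE; apply: mem_gspan; exists (x, y).
Qed.

Lemma twist_degree (X : sset) m (c : chains R (prod_sset X X)) :
  c \in chain_degree (prod_sset X X) m ->
  twist c \in chain_degree (prod_sset X X) m.
Proof.
by apply: chain_lift_degree => -[x y]; apply: mem_gspan; exists (y, x).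
Qed.

Lemma AW_tSHI_degree (X : sset) m n (c : chains R (prod_sset X X)) :
  c \in chain_degree (prod_sset X X) m ->
  AW_tSHI n c \in tensor_degree X X (m + n).
Proof.
move=> cm; apply: AW_degree; elim: n => [|n IH]; first by rewrite addn0.
by rewrite addnS iterS; apply/twist_degree/SHI_degree.
Qed.

End Degree.

(* [nested_sum n m.+1 F] is                                                  *)
(*   sum_{i_n = n}^m sum_{i_{n-1} = n-1}^{i_n - 1} ... sum_{i_0 = 0}^{i_1 - 1} *)
(*     F [:: i_0; ..; i_n].                                                  *)
Fixpoint nested_sum (M : nmodType) (n u : nat) (F : seq nat -> M) : M :=
  match n with
  | 0 => \sum_(0 <= i < u) F [:: i]
  | k.+1 => \sum_(k.+1 <= i < u) nested_sum k i (fun l => F (rcons l i))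
  end.

Section Exponents.
Local Open Scope nat_scope.
Variables (n m : nat) (I : seq nat).

Local Notation "'i_ j" := (nth 0 I j) (at level 8, j at level 2).

Definition expA : nat := n %% 8 \in [:: 3; 4; 5; 6].

(* The upper index floor((n-1)/2) is -1 for n = 0; the number of terms of    *)
(* the second sum is floor((n+1)/2) in all cases.                            *)
Definition expB : nat :=
  if n %% 4 \in [:: 1; 2] then \sum_(0 <= j < n./2.+1) 'i_(2 * j)
  else \sum_(0 <= j < n.+1./2) 'i_(2 * j + 1) + n * m.

Definition expC : nat :=
  \sum_(1 <= j < n./2.+1)
    ('i_(2 * j) + 'i_(2 * j - 1)) * \sum_(0 <= k < 2 * j) 'i_k.

Definition expD : nat :=
  if odd n then (m + 'i_n) * \sum_(0 <= k < n.+1) 'i_k else 0.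

Definition even_fst : seq nat :=
  [seq k <- iota 0 m.+1 |
    has (fun l => 'i_(2 * l) < k < 'i_(2 * l + 1)) (index_iota 0 n./2)
    || ('i_n < k)].

Definition even_snd : seq nat :=
  [seq k <- iota 0 m.+1 |
    (k < 'i_0)
    || has (fun l => 'i_(2 * l - 1) < k < 'i_(2 * l)) (index_iota 1 n./2.+1)].

Definition odd_fst : seq nat :=
  [seq k <- iota 0 m.+1 |
    has (fun l => 'i_(2 * l) < k < 'i_(2 * l + 1)) (index_iota 0 n.-1./2.+1)].

Definition odd_snd : seq nat :=
  [seq k <- iota 0 m.+1 |
    [|| k < 'i_0,
        has (fun l => 'i_(2 * l - 1) < k < 'i_(2 * l)) (index_iota 1 n.-1./2.+1)
      | 'i_n < k]].

End Exponents.

(* Main.v *)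
From HB Require Import structures.
Require Import Defs.
From mathcomp Require Import all_boot all_order all_algebra.
From mathcomp Require Import zify.
Local Open Scope ring_scope.
Set Implicit Arguments.
Unset Strict Implicit.
Unset Printing Implicit Defensive.
Import GRing.Theory.

(** Every simplex obtained from [u] by simplicial operators is given by a word:
    the nondecreasing sequence of its vertices, read as positions in [u]. Its
    class in the normalized chains vanishes as soon as two consecutive letters
    agree. In these terms, an increasing sequence [i_0 < .. < i_n] cuts
    [0 .. m] into the [n + 2] closed blocks [0 .. i_0], [i_0 .. i_1], ..,
    [i_n .. m], and the formula to be proved says that [AW (t SHI)^n] sends
    [a x b] to the signed sum, over all such sequences, of the tensors whose
    first factor is spanned by the even blocks and whose second factor is
    spanned by the odd blocks. The factor that contains the last block comes
    from [b] and the other one from [a] ([AW_tSHI_blocks]).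

    The proof is by induction on [n], using [h_(n+1) = h_n (t SHI)]. For
    [n = 0] this is the definition of [AW]. A summand of [SHI (a x b)] is a
    lattice path: it follows the diagonal from [(0, 0)] to [(r, r)], jumps to
    [(r, s)], where [r = m - p - q - 1] and [s = m - q], and then goes by unit
    steps, in the order that the shuffle prescribes, from [(r, s)] to
    [(s, m)]. Cut this path by [i_0 < .. < i_n]. After the twist, the last
    block lies on the [a] coordinate and the one before it on the [b]
    coordinate. The tensor is nonzero only if both coordinates increase
    strictly along their own blocks, and this leaves little room
    ([surviving_shuffle]):
    - the last block cannot contain the jump, which does not move [a], and
      afterwards it consists of [a]-steps;
    - the block before it consists, beyond the jump, of [b]-steps;
    - hence if [i_(n-1) >= r] then [a] would not move between [i_(n-1)] and
      [i_n], although its word reads these two positions consecutively; so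
      [i_(n-1) < r].
    Therefore the path makes its [q = m - s] [b]-steps first and its
    [a]-steps afterwards, and it is cut between them: [i_n = r + 1 + q].
    Along this path, the blocks of [(i_0, .., i_(n-1), i_n)] trace on [a] and
    [b] exactly the blocks of [(i_0, .., i_(n-1), r, s)] in [0 .. m]
    ([blocks_SHI_fst], [blocks_SHI_snd]). So the surviving summands are
    indexed by the increasing sequences of length [n + 2], and it remains to
    compare signs ([odd_exponent_step]). *)

(** * Simplices spanned by words of vertices *)

Section Spanned.
Variable X : sset.
Implicit Types (u v : simplex X) (w : seq nat).
Local Open Scope nat_scope.

Lemma const0_mono n m (i j : 'I_n.+1) :
  i <= j -> (fun=> ord0 : 'I_m.+1) i <= (fun=> ord0 : 'I_m.+1) j.
Proof. by []. Qed.

(** The constant map is the default for words that are not nondecreasing; it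
    makes [spanned] a total function. *)
Definition delta_word n m w : delta n m :=
  insubd (mk_delta (@const0_mono n m)) [ffun i : 'I_n.+1 => inord (nth 0 w i) : 'I_m.+1].

(** The simplex with vertices [w]; an empty word also gives a vertex, hence the
    side conditions [w != [::]] below. *)
Definition spanned w u : simplex X :=
  Simplex (sset_map (delta_word (size w).-1 (tag u) w) (tagged u)).

Lemma operates_spanned w u : w != [::] -> sorted leq w -> all (geq (tag u)) w ->
  operates (nth 0 w) u (spanned w u).
Proof.
move=> w0 sw wu; exists (delta_word (size w).-1 (tag u) w); split=> // i.
have lt_size (k : 'I_(size w).-1.+1) : k < size w.
  by rewrite -[X in _ < X]prednK ?ltn_ord // lt0n size_eq0.
have nthK (k : 'I_(size w).-1.+1) : nth 0 w k < (tag u).+1.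
  by rewrite ltnS; have /= := allP wu _ (mem_nth 0 (lt_size k)).
rewrite /delta_word val_insubd ifT; first by rewrite ffunE inordK.
apply/forallP=> j; apply/forallP=> k; apply/implyP=> jk.
rewrite !ffunE !inordK //.
apply: (sorted_leq_nth leq_trans leqnn 0 sw) => //; exact: lt_size.
Qed.

Lemma operates_uniq f g u v v' : operates f u v -> operates g u v' ->
  tag v = tag v' -> (forall i, i <= tag v -> f i = g i) -> v = v'.
Proof.
case: v v' => [m x] [m' y] [/= th [thE ->]] [/= et [etE ->]] mm.
move: mm et etE => <- et etE fg; congr (existT _ _ (sset_map _ _)).
by apply: deltaP => i; rewrite thE etE fg // -ltnS ltn_ord.
Qed.

(** The map of an operator is monotone only on the vertices of [v]; this is why
    [w] has to stay in that range. *)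
Lemma operates_word f u v w : operates f u v ->
  sorted leq w -> all (geq (tag v)) w ->
  sorted leq (map f w) /\ all (geq (tag u)) (map f w).
Proof.
move=> [th [thE _]] sw wv.
have fE k : k \in w -> exists2 i : 'I_(tag v).+1, i = k :> nat & f k = th i.
  move=> /(allP wv) /= kv; have kv' : k < (tag v).+1 by [].
  by exists (Ordinal kv') => //; rewrite thE.
split; last by apply/allP=> _ /mapP[k /fE[i _ ->] ->] /=; rewrite -ltnS ltn_ord.
apply: (homo_sorted_in (P := mem w)) (allss w) sw => i j.
by move=> /fE[i' <- ->] /fE[j' <- ->]; exact: delta_mono.
Qed.

(** Operators compose: this turns every summand of the iterated Shih operator
    into a simplex spanned by a word in the original simplex. *)
Lemma spanned_operates f u v w : operates f u v ->
  w != [::] -> sorted leq w -> all (geq (tag v)) w ->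
  spanned w v = spanned (map f w) u.
Proof.
move=> fuv w0 sw wv; have wO := operates_spanned w0 sw wv.
have [fw fwu] := operates_word fuv sw wv.
apply: (operates_uniq (operates_comp fuv wO) (operates_spanned _ fw fwu)).
- by case: (w) w0.
- by rewrite /= size_map.
move=> i /= iw; rewrite (nth_map 0) //.
by case: (w) w0 iw.
Qed.

Lemma spanned_iota u : spanned (iota 0 (tag u).+1) u = u.
Proof.
set w := iota _ _; have sw : sorted leq w by exact: iota_sorted.
have wu : all (geq (tag u)) w by apply/allP=> k; rewrite mem_iota.
apply: (operates_uniq (operates_spanned _ sw wu) (operates_id u)) => //=.
  by rewrite size_iota.
by move=> i; rewrite size_iota => iu; rewrite nth_iota.
Qed.

Lemma spanned_degenerate w u : w != [::] -> sorted leq w ->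
  all (geq (tag u)) w -> ~~ sorted ltn w -> degenerate (spanned w u).
Proof.
move=> w0 sw wu /(sortedP 0) nw; have wO := operates_spanned w0 sw wu.
have [j jw wj] : exists2 j, j.+1 < size w & nth 0 w j = nth 0 w j.+1.
  have [/existsP[j /andP[jw /eqP wj]]|] :=
      boolP [exists j : 'I_(size w), (j.+1 < size w) && (nth 0 w j == nth 0 w j.+1)].
    by exists j.
  move/existsPn=> nj; case: nw => j jw.
  have /(sortedP 0)/(_ _ jw) := sw; rewrite leq_eqVlt => /orP[wj|//].
  by have := nj (Ordinal (ltnW jw)); rewrite /= jw wj.
apply: (operates_degenerate wO _ wj).
by rewrite /=; move: jw; case: (size w).
Qed.

(** In an increasing face string the largest index is applied first, so no face
    shifts the indices of the later ones: the string deletes exactly the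
    vertices that it lists. *)
Lemma faces_spanned l u : sorted ltn l -> all (geq (tag u)) l ->
  size l <= tag u ->
  faces l u = spanned [seq k <- iota 0 (tag u).+1 | k \notin l] u.
Proof.
elim: l => [|i l IH].
  move=> _ _ _ /=; rewrite (eq_filter (a2 := predT)) ?filter_predT ?spanned_iota //.
rewrite [sorted _ _]/= [all _ _]/= [size _]/= [faces _ _]/=.
move=> il /andP[iu lu] sl.
have li : all (ltn i) l by rewrite (path_sortedE ltn_trans) in il; case/andP: il.
have {}IH := IH (path_sorted il) lu (ltnW sl).
set w := [seq k <- _ | _] in IH.
have lN : i \notin l by apply/negP => /(allP li) /=; rewrite ltnn.
have E (a : pred nat) : [seq k <- iota 0 (tag u).+1 | a k] =
    [seq k <- iota 0 i | a k] ++ [seq k <- iota i (tag u - i).+1 | a k].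
  by rewrite -filter_cat -[X in iota X (_ - _).+1]add0n -iotaD; congr filter; congr iota; lia.
have E0 (a : pred nat) : (forall k, k < i -> a k) -> [seq k <- iota 0 i | a k] = iota 0 i.
  by move=> ak; apply/all_filterP/allP => k; rewrite mem_iota => /= /ak.
have iE k : k < i -> k \notin l by move=> ki; apply/negP => /(allP li) /=; lia.
pose rest := [seq k <- iota i.+1 (tag u - i) | k \notin l].
have wE : w = iota 0 i ++ i :: rest by rewrite /w E E0 //= lN.
have w'E : [seq k <- iota 0 (tag u).+1 | k \notin i :: l] = iota 0 i ++ rest.
  rewrite E E0 => [|k ki]; last by rewrite inE negb_or iE // andbT; lia.
  congr (_ ++ _); rewrite /= inE eqxx /=; apply: eq_in_filter => k.
  by rewrite mem_iota inE negb_or => /andP[ik _]; rewrite (gtn_eqF ik).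
rewrite w'E; set w' := _ ++ rest.
have sw' : sorted leq w'.
  by rewrite /w' -w'E; apply: sorted_filter (iota_sorted _ _); exact: leq_trans.
have w'u : all (geq (tag u)) w'.
  by apply/allP=> k; rewrite /w' -w'E mem_filter mem_iota => /andP[_] /=.
have sz : size w = tag u - size l + 1.
  have := tag_faces l u; rewrite IH /= => <-; rewrite addn1 prednK //.
  by rewrite wE size_cat /=; lia.
have w'0 : w' != [::].
  by rewrite -size_eq0 /w' size_cat; move: sz; rewrite wE size_cat /=; lia.
have O1 := operates_spanned w'0 sw' w'u.
have sw : sorted leq w.
  by apply: sorted_filter (iota_sorted _ _); exact: leq_trans.
have wu : all (geq (tag u)) w.
  by apply/allP=> k; rewrite mem_filter mem_iota => /andP[_] /=.
have O2 := operates_spanned (_ : w != [::]) sw wu.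
rewrite -IH in O2; have tl := tag_faces l u.
(* Deleting the letter in position [i] of [w] deletes [i] itself, because the
   letters before it are [0, .., i - 1]. *)
apply: (operates_uniq (operates_comp (O2 _) (operates_fc _ _)) O1).
- by rewrite -size_eq0 sz addn1.
- by rewrite tl; lia.
- rewrite tl; have := sz; rewrite wE size_cat size_iota /=; lia.
- by rewrite tag_fc tl /= /w' size_cat; have := sz; rewrite wE size_cat /=; lia.
move=> j _ /=; rewrite wE /w' !nth_cat size_iota /bump.
case: (leqP i j) => ij /=; rewrite ?add1n ?add0n ?ij //.
by rewrite ltnNge (leqW ij) /= subSn.
Qed.

End Spanned.

(** * Blocks cut out by an increasing sequence *)

Section Blocks.
Local Open Scope nat_scope.

(** If [k] is not a cut, the number of cuts below [k] is the index of its block.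
    A cut is an endpoint of two consecutive blocks, one of each parity. *)
Definition block par I := [pred k | (k \in I) || (odd (count (gtn k) I) == par)].

Definition blocks par m I := filter (block par I) (iota 0 m.+1).

Lemma blocks_sorted par m I : sorted ltn (blocks par m I).
Proof. exact: sorted_filter ltn_trans _ _ (iota_ltn_sorted _ _). Qed.

Lemma blocks_leq par m I : all (geq m) (blocks par m I).
Proof. by apply/allP=> k; rewrite mem_filter mem_iota => /andP[_] /=. Qed.

Lemma mem_blocks par m I k : (k \in blocks par m I) = block par I k && (k <= m).
Proof. by rewrite mem_filter mem_iota. Qed.

Lemma blocks_neq0 par m I i : i \in I -> i <= m -> blocks par m I != [::].
Proof.
move=> iI im; have : i \in blocks par m I by rewrite mem_blocks inE iI im.
by case: (blocks _ _ _).
Qed.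

Lemma sorted_rcons_ltn I i :
  sorted ltn (rcons I i) = sorted ltn I && all (gtn i) I.
Proof.
by rewrite !(sorted_pairwise ltn_trans) -cats1 pairwise_cat allrel1r /= andbT andbC.
Qed.

Lemma count_gtn_nth I j k : sorted ltn I -> j < size I ->
  (nth 0 I j < k) = (j < count (gtn k) I).
Proof.
elim: I j => // i I IH j /= iI; have sI := path_sorted iI.
have li : all (ltn i) I by rewrite (path_sortedE ltn_trans) in iI; case/andP: iI.
have [ik|ki] := ltnP i k.
  by case: j => [|j] // jI; rewrite IH.
rewrite (_ : count _ I = 0).
  case: j => [|j] jI /=; first by rewrite ltnNge ki.
  by have /= := allP li _ (mem_nth 0 jI); lia.
apply/eqP; rewrite -leqn0 leqNgt -has_count; apply/hasPn=> x /(allP li) /=; lia.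
Qed.

Lemma count_leq_mem I k : sorted ltn I ->
  count (gtn k.+1) I = count (gtn k) I + (k \in I).
Proof.
move=> sI; have uI := sorted_uniq ltn_trans ltnn sI.
rewrite -(count_uniq_mem _ uI) -count_predUI.
rewrite [X in _ + X](_ : _ = 0) ?addn0; last first.
  apply/eqP; rewrite -leqn0 leqNgt -has_count; apply/hasPn=> x _ /=; lia.
by apply: eq_count => x /=; rewrite ltnS leq_eqVlt orbC.
Qed.

(** The open intervals of the face strings are the level sets, outside the cuts,
    of the number of cuts below [k]; this and the next two lemmas reduce the
    four face strings to a parity. *)
Lemma gapE I j k : sorted ltn I -> j.+1 < size I ->
  (nth 0 I j < k < nth 0 I j.+1) = (k \notin I) && (count (gtn k) I == j.+1).
Proof.
move=> sI jI; rewrite count_gtn_nth ?(ltnW jI) //.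
rewrite [k < _]ltnNge -[_ <= k]ltnS count_gtn_nth // count_leq_mem //.
by case: (k \in I) => /=; lia.
Qed.

Lemma gap_firstE I k : sorted ltn I -> 0 < size I ->
  (k < nth 0 I 0) = (k \notin I) && (count (gtn k) I == 0).
Proof.
move=> sI I0; rewrite [k < _]ltnNge -[_ <= k]ltnS count_gtn_nth // count_leq_mem //.
by case: (k \in I) => /=; lia.
Qed.

Lemma gap_lastE I n k : sorted ltn I -> size I = n.+1 ->
  (nth 0 I n < k) = (k \notin I) && (count (gtn k) I == n.+1).
Proof.
move=> sI In; rewrite count_gtn_nth ?In //.
have := count_size (gtn k.+1) I; rewrite count_leq_mem // In.
by case: (k \in I) => /=; lia.
Qed.

Section FaceLists.
Variables (n m : nat) (I : seq nat).
Hypotheses (sI : sorted ltn I) (In : size I = n.+1).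

Lemma even_fst_gap : ~~ odd n ->
  even_fst n m I = filter (predC (block false I)) (iota 0 m.+1).
Proof.
move=> n2; apply: eq_filter => k; rewrite /= (gap_lastE _ sI In).
have := count_size (gtn k) I; rewrite In.
set c := count _ _ => cn.
rewrite (@eq_in_has _ _ (fun l => (k \notin I) && (c == (2 * l).+1))).
  case: (k \in I); first by rewrite has_pred0.
  apply/orP/negP => [[/hasP[l _]|]| ]; try lia.
  move=> oc; have [->|cn'] := eqVneq c n.+1; first by right.
  by left; apply/hasP; exists c./2; rewrite ?mem_index_iota; lia.
by move=> l; rewrite mem_index_iota => /andP[_ ln]; rewrite addn1 gapE // In; lia.
Qed.

Lemma even_snd_gap : ~~ odd n ->
  even_snd n m I = filter (predC (block true I)) (iota 0 m.+1).
Proof.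
move=> n2; apply: eq_filter => k; rewrite /= gap_firstE ?In //.
have := count_size (gtn k) I; rewrite In.
set c := count _ _ => cn.
rewrite (@eq_in_has _ _ (fun l => (k \notin I) && (c == 2 * l))).
  case: (k \in I); first by rewrite has_pred0.
  apply/orP/negP => [[|/hasP[l _]]| ]; try lia.
  move=> oc; have [->|cn'] := eqVneq c 0; first by left.
  by right; apply/hasP; exists c./2; rewrite ?mem_index_iota; lia.
move=> [|l]; rewrite mem_index_iota => /andP[//] _ ln.
have -> : 2 * l.+1 - 1 = (2 * l).+1 by lia.
by rewrite mulnS gapE // In; lia.
Qed.

Lemma odd_fst_gap : odd n ->
  odd_fst n m I = filter (predC (block false I)) (iota 0 m.+1).
Proof.
move=> n2; rewrite /odd_fst; move EN: n.-1./2.+1 => N; apply: eq_filter => k /=.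
have := count_size (gtn k) I; rewrite In.
set c := count _ _ => cn.
rewrite (@eq_in_has _ _ (fun l => (k \notin I) && (c == (2 * l).+1))).
  case: (k \in I); first by rewrite has_pred0.
  apply/hasP/negP => [[l _]| ]; first lia.
  by move=> oc; exists c./2; rewrite ?mem_index_iota; lia.
by move=> l; rewrite mem_index_iota => /andP[_ ln]; rewrite addn1 gapE // In; lia.
Qed.

Lemma odd_snd_gap : odd n ->
  odd_snd n m I = filter (predC (block true I)) (iota 0 m.+1).
Proof.
move=> n2; rewrite /odd_snd; move EN: n.-1./2.+1 => N.
apply: eq_filter => k; rewrite /= gap_firstE ?In // (gap_lastE _ sI In).
have := count_size (gtn k) I; rewrite In.
set c := count _ _ => cn.
rewrite (@eq_in_has _ _ (fun l => (k \notin I) && (c == 2 * l))).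
  case: (k \in I); first by rewrite has_pred0.
  apply/or3P/negP => [[|/hasP[l _]|]| ]; try lia.
  move=> oc; have [->|c0] := eqVneq c 0; first by constructor 1.
  have [->|cn'] := eqVneq c n.+1; first by constructor 3.
  by constructor 2; apply/hasP; exists c./2; rewrite ?mem_index_iota; lia.
move=> [|l]; rewrite mem_index_iota => /andP[//] _ ln.
have -> : 2 * l.+1 - 1 = (2 * l).+1 by lia.
by rewrite mulnS gapE // In; lia.
Qed.

End FaceLists.

Lemma faces_blocks (X : sset) m (u : simplex X) par I i :
  tag u = m -> i \in I -> i <= m ->
  faces (filter (predC (block par I)) (iota 0 m.+1)) u = spanned (blocks par m I) u.
Proof.
move=> <- iI iu; rewrite faces_spanned.
- congr spanned; apply: eq_in_filter => k ku; rewrite mem_filter ku andbT /=.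
  by rewrite negbK.
- exact: sorted_filter ltn_trans _ _ (iota_ltn_sorted _ _).
- by apply/allP=> k; rewrite mem_filter mem_iota => /andP[_] /=.
rewrite -ltnS size_filter -[X in _ < X](size_iota 0) -(count_predC (block par I)).
rewrite -[X in X < _]add0n ltn_add2r -has_count; apply/hasP.
by exists i; rewrite ?mem_iota // inE iI.
Qed.

End Blocks.

Section BlockSplitting.
Local Open Scope nat_scope.
Implicit Types (par : bool) (I : seq nat).

Lemma block_above par I r k : all (gtn r) I -> r <= k ->
  block par I k = (par == odd (size I)).
Proof.
move=> Ir rk; rewrite /= (_ : count _ _ = size I); last first.
  by apply/eqP; rewrite -all_count; apply: sub_all Ir => x /=; lia.
rewrite (_ : k \in I = false) 1?eq_sym //.
by apply/negP => /(allP Ir) /=; lia.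
Qed.

Lemma filter_block_above par I r i : all (gtn r) I -> r <= i ->
  filter (block par I) (iota 0 i) = filter (block par I) (iota 0 r) ++
    (if par == odd (size I) then iota r (i - r) else [::]).
Proof.
move=> Ir ri; rewrite -{1}(subnKC ri) iotaD filter_cat add0n; congr cat.
rewrite (@eq_in_filter _ _ (fun=> par == odd (size I))) => [|k].
  by case: ifP; rewrite ?filter_predT ?filter_pred0.
by rewrite mem_iota => /andP[rk _]; rewrite (block_above _ Ir).
Qed.

(** The last cut ends the last block of [I] and starts a new one: exactly one of
    the two contains the positions beyond [i]. *)
Lemma filter_block_rcons par I i N : all (gtn i) I -> i < N ->
  filter (block par (rcons I i)) (iota 0 N) = filter (block par I) (iota 0 i) ++
    (if par == odd (size I) then [:: i] else iota i (N - i)).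
Proof.
move=> Ii iN; rewrite -{1}(subnKC (ltnW iN)) iotaD filter_cat add0n; congr cat.
  apply: eq_in_filter => k; rewrite mem_iota /= => ki.
  by rewrite mem_rcons inE (ltn_eqF ki) -cats1 count_cat /= ltnNge (ltnW ki) !addn0.
rewrite -[N - i]prednK ?subn_gt0 //= mem_rcons inE eqxx /=.
rewrite (@eq_in_filter _ _ (fun=> par != odd (size I))) => [|k].
  by case: eqP => _ /=; rewrite ?filter_predT ?filter_pred0.
rewrite mem_iota => /andP[ik _].
have Ii1 : all (gtn i.+1) (rcons I i).
  by rewrite all_rcons /= ltnSn; apply: sub_all Ii => x /=; exact: leqW.
by have := block_above par Ii1 ik; rewrite size_rcons /= => ->; case: (par) (odd _) => [][].
Qed.

End BlockSplitting.

(** * The lattice path of a shuffle *)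

Section ShihPath.
Local Open Scope nat_scope.

Lemma count_gtn0 l : count (gtn 0) l = 0.
Proof. by rewrite (eq_count (a2 := pred0)) ?count_pred0. Qed.

Lemma mem_elts N (B : {set 'I_N}) (k : 'I_N) : (nat_of_ord k \in elts B) = (k \in B).
Proof. by rewrite /elts (mem_map val_inj) mem_enum. Qed.

Lemma elts_up_set N c : c <= N -> elts [set k : 'I_N | c <= k] = iota c (N - c).
Proof.
move=> cN; apply: (irr_sorted_eq ltn_trans ltnn (elts_sorted _) (iota_ltn_sorted _ _)) => x.
rewrite mem_iota subnKC //; have [xN|Nx] := ltnP x N.
  by rewrite -[x]/(val (Ordinal xN)) mem_elts inE andbT.
by rewrite andbF; apply/negP=> /(allP (elts_ltn _)) /=; lia.
Qed.

Lemma sorted_map_ltn (f : nat -> nat) w a b :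
  sorted ltn w -> sorted ltn (map f w) -> a \in w -> b \in w -> a < b -> f a < f b.
Proof.
elim: w => //= x w IH xw fw; rewrite !inE.
move: (xw) (fw); rewrite !(path_sortedE ltn_trans) => /andP[lx sw] /andP[lfx sfw].
case/predU1P=> [->|aw]; case/predU1P=> [->|bw].
- by rewrite ltnn.
- by move=> _; apply: (allP lfx); apply: map_f.
- by have /= := allP lx _ aw; lia.
- exact: IH.
Qed.

Lemma map_shift_iota (f : nat -> nat) a b d :
  (forall k, k < d -> f (a + k) = b + k) -> map f (iota a d) = iota b d.
Proof.
elim: d a b => //= d IH a b fE; have := fE 0; rewrite !addn0 => -> //.
by rewrite (IH a.+1 b.+1) // => k kd; rewrite !addSnnS fE.
Qed.

Lemma map_id_low (f : nat -> nat) (a : pred nat) d :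
  (forall k, k < d -> f k = k) -> map f (filter a (iota 0 d)) = filter a (iota 0 d).
Proof.
move=> fE; rewrite -[RHS]map_id; apply/eq_in_map => k.
by rewrite mem_filter mem_iota => /andP[_ /fE].
Qed.

Section Path.
Variables (p q : nat).

(** The path that makes its [q] steps in the second coordinate first. *)
Definition last_shuffle : {set 'I_(p.+1 + q)} := [set k : 'I__ | q <= k].

Lemma elts_last_shuffle : elts last_shuffle = iota q p.+1.
Proof. by rewrite elts_up_set ?leq_addl // addnK. Qed.

Lemma card_last_shuffle : #|last_shuffle| = p.+1.
Proof. by rewrite -size_elts elts_last_shuffle size_iota. Qed.

Lemma shuffle_sig_last : shuffle_sig (elts last_shuffle) = p.+1 * q.
Proof.
rewrite elts_last_shuffle /shuffle_sig size_iota (eq_bigr (fun=> q)) => [|k _].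
  by rewrite sum_nat_const card_ord.
by rewrite nth_iota // addnK.
Qed.

Lemma count_last_shuffle y : y <= p.+1 + q ->
  count (gtn y) (elts last_shuffle) = y - q.
Proof.
move=> yN; rewrite elts_last_shuffle -size_filter.
have [yq|qy] := leqP y q.
  rewrite (@eq_in_filter _ _ pred0) ?filter_pred0 => [|x]; first by rewrite /=; lia.
  by rewrite mem_iota; move=> /=; lia.
by rewrite -[X in gtn X](subnKC (ltnW qy)) [filter _ _]filter_iota_ltn ?size_iota //; lia.
Qed.

Variables (m r : nat).
Hypothesis mE : m = r + p.+1 + q.
Implicit Types (A : {set 'I_(p.+1 + q)}).

Let mbE : m - p - q = r.+1. Proof. by rewrite mE; lia. Qed.
Let sE : m - q = r + p.+1. Proof. by rewrite mE; lia. Qed.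

(** [SHI_fst_map m A] and [SHI_snd_map m A] are the two coordinates of the path:
    position [r] is [(r, r)], position [r.+1] is [(r, r + p.+1)], and the unit
    step number [k], counted from [0], leaves from position [r.+1 + k]. *)
Lemma SHI_fst_map_low A j : j <= r -> SHI_fst_map m A j = j.
Proof.
move=> jr; rewrite /SHI_fst_map mbE sE /= [r < j]ltnNge jr.
have -> : j - r.+1 = 0 by lia.
by rewrite count_gtn0 ifT; lia.
Qed.

Lemma SHI_snd_map_low A j : j <= r -> SHI_snd_map m A j = j.
Proof.
move=> jr; rewrite /SHI_snd_map mbE.
have -> : j - r.+1 = 0 by lia.
by rewrite count_gtn0 ifT; lia.
Qed.

Lemma SHI_fst_map_high A y : #|A| = p.+1 -> y <= p.+1 + q ->
  SHI_fst_map m A (r.+1 + y) = r + count (gtn y) (elts A).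
Proof.
move=> cA yN; have := count_eltsC A yN.
have := count_size (gtn y) (elts A); rewrite size_elts cA.
rewrite /SHI_fst_map mbE sE addKn /= => c1 c2.
have -> : r < r.+1 + y by lia.
by rewrite ifT; lia.
Qed.

Lemma SHI_snd_map_high A y : #|A| = p.+1 -> y <= p.+1 + q ->
  SHI_snd_map m A (r.+1 + y) = r + p.+1 + count (gtn y) (elts (~: A)).
Proof.
move=> cA yN; have := count_eltsC A yN; rewrite /SHI_snd_map mbE addKn => c1.
by rewrite ifF; lia.
Qed.

Lemma SHI_fst_map_step A (k : 'I_(p.+1 + q)) : #|A| = p.+1 -> k \notin A ->
  SHI_fst_map m A (r.+1 + k).+1 = SHI_fst_map m A (r.+1 + k).
Proof.
move=> cA kA; rewrite -addnS !SHI_fst_map_high ?(ltnW (ltn_ord k)) //.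
by rewrite count_leq_mem ?elts_sorted // mem_elts (negPf kA) addn0.
Qed.

Lemma SHI_snd_map_step A (k : 'I_(p.+1 + q)) : #|A| = p.+1 -> k \in A ->
  SHI_snd_map m A (r.+1 + k).+1 = SHI_snd_map m A (r.+1 + k).
Proof.
move=> cA kA; rewrite -addnS !SHI_snd_map_high ?(ltnW (ltn_ord k)) //.
by rewrite count_leq_mem ?elts_sorted // mem_elts in_setC kA addn0.
Qed.

(** Strict growth of the first coordinate on the last block and on every second
    block before it, and of the second coordinate on the others, determines the
    path and the last cut, and keeps the other cuts on the diagonal part. *)
Lemma surviving_shuffle A I i (n := size I) : #|A| = p.+1 ->
  sorted ltn (rcons I i) -> i <= m.+1 ->
  sorted ltn (map (SHI_fst_map m A) (blocks (~~ odd n) m.+1 (rcons I i))) ->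
  sorted ltn (map (SHI_snd_map m A) (blocks (odd n) m.+1 (rcons I i))) ->
  [/\ all (gtn r) I, i = r.+1 + q & A = last_shuffle].
Proof.
move=> cA sI im sx sy.
have Ii : all (gtn i) I by move: sI; rewrite sorted_rcons_ltn => /andP[].
have x_lt := sorted_map_ltn (blocks_sorted _ _ _) sx.
have y_lt := sorted_map_ltn (blocks_sorted _ _ _) sy.
have inI par k : k \in rcons I i -> k <= m.+1 -> k \in blocks par m.+1 (rcons I i).
  by move=> kI km; rewrite mem_blocks inE kI km.
have in_last k : i <= k -> k <= m.+1 -> k \in blocks (~~ odd n) m.+1 (rcons I i).
  rewrite leq_eqVlt => /predU1P[<-|ik] km; first by rewrite inI // mem_rcons mem_head.
  rewrite mem_blocks km andbT (@block_above _ _ i.+1) ?size_rcons //.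
  by rewrite all_rcons /= ltnSn; apply: sub_all Ii => x /=; exact: leqW.
have in_prev k : all (geq k) I -> k <= i -> k \in blocks (odd n) m.+1 (rcons I i).
  move=> Ik ki; have [kI|kI] := boolP (k \in rcons I i); first exact: inI (leq_trans ki im).
  rewrite mem_blocks (leq_trans ki im) andbT inE (negPf kI) /= -cats1 count_cat /=.
  rewrite ltnNge ki /= !addn0; apply/eqP; congr odd; apply/eqP; rewrite /n -all_count.
  apply/allP => x xI; rewrite /= ltn_neqAle; have /= -> := allP Ik x xI.
  by rewrite andbT; apply: contraNneq kI => <-; rewrite mem_rcons inE xI orbT.
have x_jump : SHI_fst_map m A r.+1 = SHI_fst_map m A r.
  by rewrite [RHS]SHI_fst_map_low // -[r.+1]addn0 SHI_fst_map_high // count_gtn0 addn0.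
(* Otherwise the last block would contain the jump, where the first coordinate
   stays at [r]. *)
have ri : r < i.
  rewrite ltnNge; apply/negP => ir.
  by have := x_lt r r.+1 (in_last _ _ _) (in_last _ _ _); rewrite x_jump ltnn; lia.
(* Beyond the jump, the second coordinate moves at every step between the last
   two cuts. *)
have stepN k : r < k -> k < i -> all (geq k) I ->
    exists2 c : 'I_(p.+1 + q), k = r.+1 + c & c \notin A.
  move=> rk ki Ik; have cN : k - r.+1 < p.+1 + q by move: im; rewrite mE; lia.
  have kE : k = r.+1 + (k - r.+1) by lia.
  exists (Ordinal cN) => //; apply/negP=> cinA.
  have Ik1 : all (geq k.+1) I by apply: sub_all Ik => x /=; exact: leqW.
  have := y_lt k k.+1 (in_prev _ Ik (ltnW ki)) (in_prev _ Ik1 ki) (ltnSn k).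
  by have /= := SHI_snd_map_step cA cinA; rewrite -kE => ->; rewrite ltnn.
(* If the previous cut [j] were at [r] or later, the first coordinate would be
   constant on [j .. i], while [j] and [i] are both cuts, hence in its word. *)
have Ir : all (gtn r) I.
  case/lastP: I @n sI Ii sx sy x_lt y_lt inI in_last in_prev stepN => // I j n.
  rewrite !all_rcons => sI /andP[/= ji _] _ _ x_lt _ inI _ _ stepN.
  have Ij : all (gtn j) I by move: sI; rewrite !sorted_rcons_ltn => /andP[/andP[]].
  rewrite andbC; have [rj|jr] := leqP r j; last by rewrite (sub_all _ Ij) // => x /=; lia.
  suff xE d : j + d <= i -> SHI_fst_map m A (j + d) = SHI_fst_map m A j.
    have jI : j \in rcons (rcons I j) i by rewrite mem_rcons inE mem_rcons mem_head orbT.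
    have iI : i \in rcons (rcons I j) i by rewrite mem_rcons mem_head.
    have := x_lt j i (inI _ _ jI (leq_trans (ltnW ji) im)) (inI _ _ iI im) ji.
    by rewrite -(subnKC (ltnW ji)) xE ?ltnn // subnKC // ltnW.
  elim: d => [|d IH] jd; rewrite ?addn0 // -[RHS]IH ?addnS; last by lia.
  have [jr|jr] := eqVneq (j + d) r; first by rewrite jr.
  have [|||c -> cA'] := stepN (j + d); try lia.
    rewrite all_rcons /= leq_addr; apply: sub_all Ij => x /=; lia.
  exact: SHI_fst_map_step.
have {}stepN k : k \in A -> i <= r.+1 + k.
  move=> kA; rewrite leqNgt; apply/negP=> ki.
  have [|||c /addnI/val_inj <-] := stepN (r.+1 + k); rewrite ?kA //; first by lia.
  by apply: sub_all Ir => x /=; lia.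
(* From the last cut on the first coordinate moves at every step. *)
have stepY (k : 'I_(p.+1 + q)) : i <= r.+1 + k -> k \in A.
  move=> ik; apply/negPn/negP=> kA; have := SHI_fst_map_step cA kA.
  have km : (r.+1 + k).+1 <= m.+1 by have := ltn_ord k; rewrite mE; lia.
  have := x_lt _ _ (in_last _ ik (ltnW km)) (in_last _ (leqW ik) km) (ltnSn _).
  by move=> /[swap] ->; rewrite ltnn.
have AE : A = [set k : 'I__ | i - r.+1 <= k].
  by apply/setP=> k; rewrite inE; apply/idP/idP => [/stepN|?]; [lia | apply: stepY; lia].
(* The path has [p.+1] steps in the first coordinate in all. *)
have iq : i - r.+1 = q.
  have iN : i - r.+1 <= p.+1 + q by move: im; rewrite mE; lia.
  by have := cA; rewrite AE -size_elts elts_up_set // size_iota; lia.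
by split=> //; [lia | rewrite AE iq].
Qed.

(** The last block, which starts after the [q] steps of the second coordinate,
    is carried to [r .. r + p.+1], the block between the two new cuts. *)
Lemma blocks_SHI_fst I (n := size I) : all (gtn r) I ->
  map (SHI_fst_map m last_shuffle) (blocks (~~ odd n) m.+1 (rcons I (r.+1 + q))) =
  blocks (~~ odd n) m (rcons (rcons I r) (r + p.+1)).
Proof.
move=> Ir; have Ii : all (gtn (r.+1 + q)) I by apply: sub_all Ir => x /=; lia.
have Is : all (gtn (r + p.+1)) (rcons I r).
  by rewrite all_rcons /= -[X in X < _]addn0 ltn_add2l; apply: sub_all Ir => x /=; lia.
have nE : (~~ odd n == odd n) = false by case: odd.
rewrite /blocks !filter_block_rcons //; try (try rewrite mE; lia).
rewrite (@filter_block_above _ _ r) //; last by lia.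
rewrite size_rcons /= nE cats0 !eqxx map_cat map_id_low => [|k kr]; last first.
  by rewrite SHI_fst_map_low // ltnW.
rewrite -catA; congr cat; rewrite -[[:: _]]/(iota (r + p.+1) 1).
have -> : r + p.+1 - r = p.+1 by lia.
rewrite -iotaD; have -> : m.+2 - (r.+1 + q) = p.+1 + 1 by rewrite mE; lia.
apply: map_shift_iota => k kp.
rewrite -addnA SHI_fst_map_high ?card_last_shuffle //; last by lia.
by rewrite count_last_shuffle; lia.
Qed.

(** The block that contains the jump is carried to the block that ends at the new
    cut [r], followed by the new last block [r + p.+1 .. m]. *)
Lemma blocks_SHI_snd I (n := size I) : all (gtn r) I ->
  map (SHI_snd_map m last_shuffle) (blocks (odd n) m.+1 (rcons I (r.+1 + q))) =
  blocks (odd n) m (rcons (rcons I r) (r + p.+1)).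
Proof.
move=> Ir; have Ii : all (gtn (r.+1 + q)) I by apply: sub_all Ir => x /=; lia.
have Is : all (gtn (r + p.+1)) (rcons I r).
  by rewrite all_rcons /= -[X in X < _]addn0 ltn_add2l; apply: sub_all Ir => x /=; lia.
have nE : (odd n == ~~ odd n) = false by case: odd.
rewrite /blocks !filter_block_rcons //; try (try rewrite mE; lia).
rewrite (@filter_block_above _ _ r) //; last by lia.
rewrite size_rcons /= nE !eqxx !map_cat map_id_low => [|k kr]; last first.
  by rewrite SHI_snd_map_low // ltnW.
rewrite -!catA; congr cat.
have -> : r.+1 + q - r = q.+1 by lia.
have -> : [:: r.+1 + q] = iota (r + q.+1) 1 by rewrite addSnnS.
rewrite -map_cat -iotaD addn1 -[iota r _]/(r :: iota r.+1 q.+1) map_cons.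
rewrite SHI_snd_map_low //; congr cons.
have -> : m.+1 - (r + p.+1) = q.+1 by rewrite mE; lia.
apply: map_shift_iota => k kp; rewrite SHI_snd_map_high ?card_last_shuffle //; last by lia.
by have := @count_eltsC _ last_shuffle k; rewrite count_last_shuffle; lia.
Qed.

End Path.

End ShihPath.

(** * Signs *)

Section Exponent.
Local Open Scope nat_scope.
Implicit Types (I : seq nat).

Definition exponent n m I := expA n + expB n m I + expC n I + expD n m I.

(** The value of [A] changes exactly between [2] and [3], and between [6] and [7],
    modulo [8]. *)
Lemma expA_step n : odd (expA n.+1) = odd (expA n) (+) (n %% 4 == 2).
Proof. by rewrite /expA !inE; lia. Qed.

Lemma sum_nth_rcons I x K (f : nat -> nat) : (forall j, j < K -> f j < size I) ->
  \sum_(0 <= j < K) nth 0 (rcons I x) (f j) = \sum_(0 <= j < K) nth 0 I (f j).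
Proof. by move=> fI; apply: eq_big_nat => j /fI jI; rewrite nth_rcons jI. Qed.

Lemma sum_even_odd (g : nat -> nat) k :
  \sum_(0 <= i < 2 * k) g i =
  \sum_(0 <= j < k) g (2 * j) + \sum_(0 <= j < k) g (2 * j + 1).
Proof.
elim: k => [|k IH]; first by rewrite muln0 !big_geq.
rewrite mulnS !add2n !big_nat_recr //= IH addn1; lia.
Qed.

Lemma expC_rcons n I x : n./2.*2 < size I -> expC n (rcons I x) = expC n I.
Proof.
move=> nI; apply: eq_big_nat => j /andP[j1 jn].
rewrite (@sum_nth_rcons I x (2 * j) id) => [|i ij]; last by lia.
by rewrite !nth_rcons !ifT; lia.
Qed.

Lemma expC_recr k I : expC k.*2.+2 I =
  expC k.*2 I + (nth 0 I k.*2.+2 + nth 0 I k.*2.+1) * \sum_(0 <= i < k.*2.+2) nth 0 I i.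
Proof.
rewrite /expC /= doubleK big_nat_recr //=; congr (_ + (nth 0 I _ + nth 0 I _) * _); try lia.
by congr bigop; congr index_iota; lia.
Qed.

(** The exponent [C] only sees the cuts up to the last even index, so that its
    summation range grows only when [n] becomes even. *)
Lemma expC_double n I : expC n I = expC n./2.*2 I.
Proof. by rewrite /expC doubleK. Qed.

Lemma expC_even_step k I r s t (g := nth 0 I) : size I = k.*2.+2 ->
  expC k.*2.+3 (rcons (rcons I r) s) =
    expC k.*2 I + (r + g k.*2.+1) * \sum_(0 <= i < k.*2.+2) g i /\
  expC k.*2.+2 (rcons I t) =
    expC k.*2 I + (t + g k.*2.+1) * \sum_(0 <= i < k.*2.+2) g i.
Proof.
move=> sI; have E x : expC k.*2.+2 (rcons I x) =
    expC k.*2 I + (x + g k.*2.+1) * \sum_(0 <= i < k.*2.+2) g i.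
  rewrite expC_recr expC_rcons ?doubleK ?sI 1?ltnW //.
  rewrite !nth_rcons sI ltnn eqxx ltnSn.
  by rewrite (@sum_nth_rcons I x _ id) // sI.
split=> //; rewrite expC_double /= uphalf_double expC_rcons ?E //.
by rewrite size_rcons sI /= doubleK doubleS.
Qed.

Lemma expC_odd_step k I r s t (g := nth 0 I) : size I = k.*2.+1 ->
  expC k.*2.+2 (rcons (rcons I r) s) =
    expC k.*2 I + (s + r) * (\sum_(0 <= i < k.*2.+1) g i + r) /\
  expC k.*2.+1 (rcons I t) = expC k.*2 I.
Proof.
move=> sI; split; last first.
  by rewrite expC_double /= uphalf_double expC_rcons // doubleK sI.
rewrite expC_recr !expC_rcons ?size_rcons ?doubleK ?sI ?leqnSn //.
rewrite !nth_rcons !size_rcons sI ltnn eqxx ltnSn ltnn eqxx.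
rewrite (@sum_nth_rcons _ s _ id) ?size_rcons ?sI // big_nat_recr //=.
by rewrite nth_rcons sI ltnn eqxx (@sum_nth_rcons _ r _ id) // sI.
Qed.

(** Passing from the cuts [rcons I (r.+1 + q)] in dimension [m.+1] to
    [rcons (rcons I r) s] in dimension [m] costs the sign of the summand of the
    Shih operator: [p.+1 * q] is the signature of the surviving shuffle. The
    entries of [I] occur only through the sums [Ev] and [Od] over its even and
    odd places and through a common part of the exponents [C], so the parity
    of [n], and that of [k] with [n = 2k] or [n = 2k + 1], leave four Boolean
    identities. *)
Lemma odd_exponent_step m n I p q r (s := r + p.+1) : size I = n ->
  m = r + p.+1 + q ->
  odd (exponent n.+1 m (rcons (rcons I r) s)) =
  odd (exponent n m.+1 (rcons I (r.+1 + q))) (+) odd (r.+1 + p.+1 * q + 1).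
Proof.
move=> sI mE; set t := r.+1 + q; pose g := nth 0 I.
pose Ev k := \sum_(0 <= j < k) g (2 * j); pose Od k := \sum_(0 <= j < k) g (2 * j + 1).
have nth_n x : nth 0 (rcons I x) n = x by rewrite nth_rcons sI ltnn eqxx.
have nth_nS : nth 0 (rcons (rcons I r) s) n = r.
  by rewrite nth_rcons size_rcons sI ltnSn nth_n.
have nth_Sn : nth 0 (rcons (rcons I r) s) n.+1 = s.
  by rewrite nth_rcons size_rcons sI ltnn eqxx.
have sum1 x K (f : nat -> nat) : (forall j, j < K -> f j < n) ->
    \sum_(0 <= j < K) nth 0 (rcons I x) (f j) = \sum_(0 <= j < K) g (f j).
  by move=> fn; apply: sum_nth_rcons; rewrite sI.
have sum2 K (f : nat -> nat) : (forall j, j < K -> f j < n) ->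
    \sum_(0 <= j < K) nth 0 (rcons (rcons I r) s) (f j) = \sum_(0 <= j < K) g (f j).
  move=> fn; rewrite sum_nth_rcons ?sum1 // => j /fn; rewrite size_rcons sI.
  exact: ltnW.
rewrite /exponent !(oddM, oddD, oddS) expA_step.
have [k nE] : exists k, n = k.*2 + odd n by exists n./2; lia.
move: nE; case: (boolP (odd n)) => n2 nE.
- rewrite addn1 in nE.
  have [C1 C2] := @expC_odd_step k I r s t (etrans sI nE).
  have SE : \sum_(0 <= i < n) g i = Ev k.+1 + Od k.
    by rewrite nE -mul2n big_nat_recr //= sum_even_odd /Ev big_nat_recr //= addnAC.
  have DE : expD n m.+1 (rcons I t) = (m.+1 + t) * (\sum_(0 <= i < n) g i + t).
    by rewrite /expD n2 big_nat_recr //= nth_n (sum1 t n id).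
  have BE : expB n m.+1 (rcons I t) =
      if odd k then Od k + t + n * m.+1 else Ev k.+1.
    rewrite /expB !inE (_ : (_ || _) = ~~ odd k); last by lia.
    rewrite (_ : n./2.+1 = k.+1) 1?(_ : n.+1./2 = k.+1); try by lia.
    case: (odd k) => /=; last by rewrite sum1 // => j; lia.
    rewrite big_nat_recr //= sum1 => [|j]; last by lia.
    by rewrite (_ : 2 * k + 1 = n) ?nth_n //; lia.
  have BE' : expB n.+1 m (rcons (rcons I r) s) =
      if odd k then Od k + r + n.+1 * m else Ev k.+1 + s.
    rewrite /expB !inE (_ : (_ || _) = ~~ odd k); last by lia.
    rewrite (_ : n.+1./2.+1 = k.+2) 1?(_ : n.+2./2 = k.+1); try by lia.
    case: (odd k) => /=; rewrite big_nat_recr //= sum2 => [|j]; try by lia.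
      by rewrite (_ : 2 * k + 1 = n) ?nth_nS //; lia.
    by rewrite (_ : 2 * k.+1 = n.+1) ?nth_Sn //; lia.
  have mod2 : (n %% 4 == 2) = false by lia.
  have {C1} C1 : expC n.+1 (rcons (rcons I r) s) = expC k.*2 I + (s + r) * (Ev k.+1 + Od k + r).
    by rewrite -SE nE.
  have {C2} C2 : expC n (rcons I t) = expC k.*2 I by rewrite nE.
  have D0 : expD n.+1 m (rcons (rcons I r) s) = 0 by rewrite /expD /= n2.
  rewrite C1 C2 BE BE' DE SE D0 mod2 /t /s mE.
  move: (Ev _) (Od _) (expC _ _) (expA _) => e o c a.
  case: (odd k); rewrite !(oddM, oddD, oddS) ?n2 /=.
    by case: (odd e) (odd o) (odd c) (odd a) (odd r) (odd p) (odd q) => [][][][][][][].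
  by case: (odd e) (odd o) (odd c) (odd a) (odd r) (odd p) (odd q) => [][][][][][][].
rewrite addn0 in nE.
have SE : \sum_(0 <= i < n) g i = Ev k + Od k by rewrite nE -mul2n sum_even_odd.
have DE : expD n.+1 m (rcons (rcons I r) s) = (m + s) * (\sum_(0 <= i < n) g i + r + s).
  rewrite /expD /= n2 !big_nat_recr //= nth_nS nth_Sn.
  by rewrite (sum2 n id).
have BE : expB n m.+1 (rcons I t) =
    if odd k then Ev k + t else Od k + n * m.+1.
  rewrite /expB !inE (_ : (_ || _) = odd k); last by lia.
  rewrite (_ : n./2.+1 = k.+1) 1?(_ : n.+1./2 = k); try by lia.
  case: (odd k) => /=; last by rewrite sum1 // => j; lia.
  rewrite big_nat_recr //= sum1 => [|j]; last by lia.
  by rewrite (_ : 2 * k = n) ?nth_n //; lia.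
have BE' : expB n.+1 m (rcons (rcons I r) s) =
    if odd k then Od k + s + n.+1 * m else Ev k + r.
  rewrite /expB !inE (_ : (_ || _) = ~~ odd k); last by lia.
  rewrite (_ : n.+1./2.+1 = k.+1) 1?(_ : n.+2./2 = k.+1); try by lia.
  case: (odd k) => /=; rewrite big_nat_recr //= sum2 => [|j]; try by lia.
    by rewrite (_ : 2 * k + 1 = n.+1) ?nth_Sn //; lia.
  by rewrite (_ : 2 * k = n) ?nth_nS //; lia.
have mod2 : (n %% 4 == 2) = odd k by lia.
have CE : odd (expC n.+1 (rcons (rcons I r) s)) =
    odd (expC n (rcons I t)) (+) (odd (r + t) && odd (Ev k + Od k)).
  case: k nE SE {DE BE BE' mod2} => [|k] nE SE.
    by rewrite nE /expC !big_geq // /Ev /Od !big_geq // andbF.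
  have [C1 C2] := @expC_even_step k I r s t (etrans sI nE).
  have parity c x y z S : odd (c + (x + z) * S) =
      odd (c + (y + z) * S) (+) (odd (x + y) && odd S).
    rewrite !(oddM, oddD); move: (odd c) (odd x) (odd y) (odd z) (odd S).
    by do 5!case.
  by rewrite -SE nE C1 C2; exact: parity.
have D0 : expD n m.+1 (rcons I t) = 0 by rewrite /expD (negPf n2).
rewrite CE BE BE' DE SE D0 mod2 /t /s mE.
move: (Ev _) (Od _) (expC _ _) (expA _) => e o c a.
case: (odd k); rewrite !(oddM, oddD, oddS) ?(negPf n2) /=.
  by case: (odd e) (odd o) (odd c) (odd a) (odd r) (odd p) (odd q) => [][][][][][][].
by case: (odd e) (odd o) (odd c) (odd a) (odd r) (odd p) (odd q) => [][][][][][][].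
Qed.

End Exponent.

(** * Sums over increasing sequences *)

Section IncreasingSum.

(** Unlike [nested_sum], this allows the empty sequence and carries no lower
    bounds on the entries: they only remove empty sums. *)
Fixpoint increasing_sum (M : nmodType) (k u : nat) (F : seq nat -> M) : M :=
  if k is k'.+1 then
    \sum_(i < u) increasing_sum k' i (fun I => F (rcons I i))
  else F [::].

Lemma eq_increasing_sum (M : nmodType) k u (F G : seq nat -> M) :
  (forall I, size I = k -> sorted ltn I -> all (gtn u) I -> F I = G I) ->
  increasing_sum k u F = increasing_sum k u G.
Proof.
elim: k u F G => [|k IH] u F G FG /=; first exact: FG.
apply: eq_bigr => i _; apply: IH => I sI lI Ii; apply: FG.
- by rewrite size_rcons sI.
- by rewrite sorted_rcons_ltn lI.
by rewrite all_rcons /= ltn_ord; apply: sub_all Ii => x /= /ltn_trans; apply.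
Qed.

Lemma increasing_sum0 (M : nmodType) k u (F : seq nat -> M) :
  (forall I, size I = k -> sorted ltn I -> all (gtn u) I -> F I = 0) ->
  increasing_sum k u F = 0.
Proof.
move/eq_increasing_sum=> ->.
by elim: k u => //= k IH u; apply: big1 => i _; exact: IH.
Qed.

Lemma increasing_sum_short (M : nmodType) k u (F : seq nat -> M) :
  (u < k)%N -> increasing_sum k u F = 0.
Proof.
elim: k u F => //= k IH u F uk; apply: big1 => i _; apply: IH.
by rewrite (leq_trans (ltn_ord i)).
Qed.

Lemma increasing_sum_narrow (M : nmodType) k r u (F : seq nat -> M) : (r <= u)%N ->
  (forall I, size I = k -> sorted ltn I -> all (gtn u) I -> ~~ all (gtn r) I -> F I = 0) ->
  increasing_sum k u F = increasing_sum k r F.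
Proof.
case: k => //= k ru F0.
rewrite -(big_mkord xpredT (fun i => increasing_sum k i (fun I => F (rcons I i)))).
rewrite (big_cat_nat (leq0n r) ru) /= big_mkord [X in _ + X]big1_seq ?addr0 //.
move=> i; rewrite mem_index_iota => /andP[_ /andP[ri iu]].
apply: increasing_sum0 => I sI lI Ii; apply: F0; first by rewrite size_rcons sI.
- by rewrite sorted_rcons_ltn lI.
- by rewrite all_rcons /= iu; apply: sub_all Ii => x /= /ltn_trans; apply.
by rewrite all_rcons /= ltnNge ri.
Qed.

Lemma increasing_sumZ (R : pzRingType) (M : lmodType R) k u c (F : seq nat -> M) :
  c *: increasing_sum k u F = increasing_sum k u (fun I => c *: F I).
Proof.
elim: k u F => //= k IH u F; rewrite scaler_sumr; apply: eq_bigr => i _; exact: IH.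
Qed.

Lemma increasing_sum1 (M : nmodType) u (F : seq nat -> M) :
  increasing_sum 1 u F = \sum_(i < u) F [:: i : nat].
Proof. by []. Qed.

Lemma increasing_sumS (M : nmodType) k u (F : seq nat -> M) :
  increasing_sum k.+1 u F = \sum_(i < u) increasing_sum k i (fun I => F (rcons I i)).
Proof. by []. Qed.

Lemma nested_sumE (M : nmodType) n u (F : seq nat -> M) :
  nested_sum n u F = increasing_sum n.+1 u F.
Proof.
elim: n u F => [|n IH] u F; first by rewrite /= big_mkord.
rewrite [LHS]/=; under eq_bigr do rewrite IH.
rewrite -[RHS](big_mkord xpredT (fun i => increasing_sum n.+1 i (fun I => F (rcons I i)))).
have [nu|un] := leqP n.+1 u.
  rewrite (big_cat_nat (leq0n n.+1) nu) [X in _ = X + _]big1_seq ?add0r //.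
  move=> i; rewrite mem_index_iota => /andP[_ ni].
  exact: increasing_sum_short ni.
rewrite big_geq 1?ltnW // big1_seq // => i; rewrite mem_index_iota => /andP[_ iu].
by apply: (@increasing_sum_short _ n.+1); apply: ltn_trans un.
Qed.

End IncreasingSum.

(** * The induction *)

Section Step.
Variables (R : comPzRingType) (X : sset).
Implicit Types (u v : simplex X).

Lemma AW_tSHI_is_linear n : linear (@AW_tSHI R X n).
Proof.
move=> c x y; rewrite /AW_tSHI -linearP; congr AW.
by elim: n => //= n ->; rewrite !linearP.
Qed.

HB.instance Definition _ n :=
  GRing.isLinear.Build R _ _ *:%R (@AW_tSHI R X n) (AW_tSHI_is_linear n).

Lemma twist_cross u v : tag u = tag v -> twist (cross R u v) = cross R v u.
Proof.
case: u v => [m a] [m' b] /= mm; case: _ / mm b => b.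
by rewrite -!/(Simplex _) !crossE /twist chain_liftE.
Qed.

(** The even blocks make up the first tensor factor; they lie on the first
    simplex for [n] even and on the second for [n] odd. *)
Definition twisted_tens (o : bool) (x y : chains R X) : tensor (chains R X) (chains R X) :=
  if o then tens y x else tens x y.

Definition block_tens n m I u v :=
  twisted_tens (odd n) (cls R (spanned (blocks (odd n) m I) u))
    (cls R (spanned (blocks (~~ odd n) m I) v)).

Section OnePath.
Variables (m p q r n : nat).
Hypothesis mE : m = (r + p.+1 + q)%N.
Variables (a b : simplex X).
Hypotheses (am : tag a = m) (bm : tag b = m).
Implicit Types (A : {set 'I_(p.+1 + q)}).

Let qm : (q < m)%N. Proof. by rewrite mE; lia. Qed.
Let pmq : (p < m - q)%N. Proof. by rewrite mE; lia. Qed.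

Lemma block_tens_SHI A I : #|A| = p.+1 -> size I = n.+1 -> all (gtn m.+2) I ->
  block_tens n m.+1 I (SHI_snd m A b) (SHI_fst m A a) =
  twisted_tens (odd n)
    (cls R (spanned (map (SHI_snd_map m A) (blocks (odd n) m.+1 I)) b))
    (cls R (spanned (map (SHI_fst_map m A) (blocks (~~ odd n) m.+1 I)) a)).
Proof.
move=> cA sI Im; have fO := operates_SHI_fst qm pmq cA am.
have gO := operates_SHI_snd qm pmq cA bm.
have [i iI] : exists i, i \in I by case: (I) sI => // i I' _; exists i; exact: mem_head.
have im : (i <= m.+1)%N by have := allP Im i iI.
have w0 par := blocks_neq0 par iI im.
have sw par : sorted leq (blocks par m.+1 I).
  exact: sub_sorted ltnW _ (blocks_sorted _ _ _).
have wf par : all (geq (tag (SHI_fst m A a))) (blocks par m.+1 I).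
  by rewrite (tag_SHI_fst qm pmq cA am); exact: blocks_leq.
have wg par : all (geq (tag (SHI_snd m A b))) (blocks par m.+1 I).
  by rewrite (tag_SHI_snd qm pmq cA bm); exact: blocks_leq.
rewrite /block_tens (spanned_operates gO (w0 _) (sw _) (wg _)).
by rewrite (spanned_operates fO (w0 _) (sw _) (wf _)).
Qed.

Lemma twisted_tens0 o x y : x = 0 \/ y = 0 -> twisted_tens o x y = 0.
Proof. by case: o => -[] ->; rewrite /= ?tens0l ?tens0r. Qed.

(** All summands of the Shih operator other than the surviving one give a factor
    whose word repeats a letter. *)
Lemma block_tens_SHI0 A I i : #|A| = p.+1 -> size I = n ->
  sorted ltn (rcons I i) -> all (gtn m.+2) (rcons I i) ->
  ~ [/\ all (gtn r) I, i = (r.+1 + q)%N & A = last_shuffle p q] ->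
  block_tens n m.+1 (rcons I i) (SHI_snd m A b) (SHI_fst m A a) = 0.
Proof.
move=> cA sI lI Im nS; rewrite block_tens_SHI ?size_rcons ?sI //.
have im : (i <= m.+1)%N by move: Im; rewrite all_rcons => /andP[].
have iI : i \in rcons I i by rewrite mem_rcons mem_head.
have sw par : sorted leq (blocks par m.+1 (rcons I i)).
  exact: sub_sorted ltnW _ (blocks_sorted _ _ _).
have wm par := blocks_leq par m.+1 (rcons I i).
have w0 par (f : nat -> nat) : map f (blocks par m.+1 (rcons I i)) != [::].
  by rewrite -size_eq0 size_map size_eq0 (blocks_neq0 _ iI im).
apply: twisted_tens0.
have [sy|/negP sy] := boolP
  (sorted ltn (map (SHI_snd_map m A) (blocks (odd n) m.+1 (rcons I i)))).
  right; have [sx|nx] := boolP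
    (sorted ltn (map (SHI_fst_map m A) (blocks (~~ odd n) m.+1 (rcons I i)))).
    by case: nS; apply: (surviving_shuffle mE cA lI im); rewrite sI.
  apply/cls_degenerate/spanned_degenerate => //;
  by have [] := operates_word (operates_SHI_fst qm pmq cA am) (sw (~~ odd n)); rewrite ?tag_SHI_fst.
left; apply/cls_degenerate/spanned_degenerate; try exact/negP; rewrite ?w0 //;
by have [] := operates_word (operates_SHI_snd qm pmq cA bm) (sw (odd n)); rewrite ?tag_SHI_snd.
Qed.

Lemma block_tens_last_shuffle I : size I = n -> all (gtn r) I ->
  block_tens n m.+1 (rcons I (r.+1 + q)%N)
    (SHI_snd m (last_shuffle p q) b) (SHI_fst m (last_shuffle p q) a) =
  block_tens n.+1 m (rcons (rcons I r) (r + p.+1)%N) a b.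
Proof.
move=> sI Ir; have sI' i : size (rcons I i) = n.+1 by rewrite size_rcons sI.
have Im : all (gtn m.+2) (rcons I (r.+1 + q)%N).
  rewrite all_rcons /= mE; apply/andP; split; first lia.
  by apply: sub_all Ir => x /=; lia.
rewrite (block_tens_SHI (card_last_shuffle p q) (sI' _) Im).
move: (blocks_SHI_fst mE Ir) (blocks_SHI_snd mE Ir); rewrite sI => -> ->.
by rewrite /block_tens /twisted_tens [odd n.+1]/= negbK; case: (odd n).
Qed.

(** The part of the induction step for fixed [p] and [q], that is, for fixed new
    cuts [r] and [s]: only one shuffle contributes, and only with last cut
    [r.+1 + q] and with the other cuts below [r]. *)
Lemma sum_shuffles (s := (r + p.+1)%N) :
  (forall u v, tag u = m.+1 -> tag v = m.+1 -> AW_tSHI n (cross R u v) =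
    increasing_sum n.+1 m.+2 (fun I => (-1) ^+ exponent n m.+1 I *: block_tens n m.+1 I u v)) ->
  \sum_(A : {set 'I_(p.+1 + q)} | #|A| == p.+1)
    (-1) ^+ ((m - p - q) + shuffle_sig (elts A) + 1)%N *:
      AW_tSHI n (cross R (SHI_snd m A b) (SHI_fst m A a)) =
  increasing_sum n r (fun I =>
    (-1) ^+ exponent n.+1 m (rcons (rcons I r) s) *:
      block_tens n.+1 m (rcons (rcons I r) s) a b).
Proof.
move=> IH; rewrite (bigD1 (last_shuffle p q)) ?card_last_shuffle //=.
rewrite [X in _ + X]big1 ?addr0 => [|A /andP[/eqP cA nA]]; last first.
  rewrite IH ?tag_SHI_fst ?tag_SHI_snd // increasing_sum0 ?scaler0 //.
  move=> I; case/lastP: I => // I i; rewrite size_rcons => -[sI] lI Ii.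
  rewrite block_tens_SHI0 ?scaler0 // => -[_ _ AE]; by rewrite AE eqxx in nA.
rewrite IH ?tag_SHI_fst ?tag_SHI_snd ?card_last_shuffle // increasing_sumZ /=.
have tm : (r.+1 + q < m.+2)%N by rewrite mE; lia.
rewrite (bigD1 (Ordinal tm)) //= [X in _ + X]big1 ?addr0 => [|i ni]; last first.
  apply: increasing_sum0 => I sI lI Ii.
  rewrite block_tens_SHI0 ?scaler0 ?card_last_shuffle //.
  - by rewrite sorted_rcons_ltn lI.
  - by rewrite all_rcons /= ltn_ord; apply: sub_all Ii => x /= /ltn_trans; apply.
  by case=> _ iE _; case/eqP: ni; apply: val_inj.
rewrite (@increasing_sum_narrow _ _ r) //=; first last.
- move=> I sI lI Ii nI; rewrite block_tens_SHI0 ?scaler0 ?card_last_shuffle //.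
  + by rewrite sorted_rcons_ltn lI.
  + by rewrite all_rcons /= tm; apply: sub_all Ii => x /= /ltn_trans; apply.
  by case=> Ir; rewrite Ir in nI.
- by lia.
apply: eq_increasing_sum => I sI lI Ir.
rewrite block_tens_last_shuffle // scalerA; congr (_ *: _).
rewrite -exprD -[RHS]signr_odd (odd_exponent_step sI mE) -oddD signr_odd.
rewrite shuffle_sig_last (_ : (m - p - q)%N = r.+1); last by rewrite mE; lia.
by rewrite addnC.
Qed.

End OnePath.

Lemma AW_cross m (a b : X m) :
  AW (cross R (Simplex a) (Simplex b)) =
  \sum_(i < m.+1) tens (cls R (faces (index_iota i.+1 m.+1) (Simplex a)))
                       (cls R (faces (index_iota 0 i) (Simplex b))).
Proof. by rewrite crossE /AW chain_liftE. Qed.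

Lemma faces_blocks1 m (i : 'I_m.+1) u : tag u = m ->
  faces (index_iota i.+1 m.+1) u = spanned (blocks false m [:: i : nat]) u /\
  faces (index_iota 0 i) u = spanned (blocks true m [:: i : nat]) u.
Proof.
move=> um; have im := ltn_ord i.
have FB par := faces_blocks par um (mem_head (i : nat) [::]) im.
split; rewrite -FB; congr faces; apply: (irr_sorted_eq ltn_trans ltnn);
  try exact: iota_ltn_sorted;
  try exact: sorted_filter ltn_trans _ _ (iota_ltn_sorted _ _);
  by move=> k; rewrite mem_index_iota mem_filter mem_iota /= inE; lia.
Qed.

Lemma AW_tSHI_recl n m u v : tag u = m -> tag v = m ->
  AW_tSHI n.+1 (cross R u v) = \sum_(q < m) \sum_(p < m - q)
    \sum_(A : {set 'I_(p.+1 + q)} | #|A| == p.+1)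
      (-1) ^+ ((m - p - q) + shuffle_sig (elts A) + 1)%N *:
        AW_tSHI n (cross R (SHI_snd m A v) (SHI_fst m A u)).
Proof.
move=> um vm; have -> : AW_tSHI n.+1 (cross R u v) = AW_tSHI n (twist (SHI (cross R u v))).
  by rewrite /AW_tSHI iterSr.
have -> : SHI (cross R u v) = \sum_(q < m) \sum_(p < m - q)
    \sum_(A : {set 'I_(p.+1 + q)} | #|A| == p.+1)
      (-1) ^+ ((m - p - q) + shuffle_sig (elts A) + 1)%N *:
        cross R (SHI_fst m A u) (SHI_snd m A v).
  case: u v um vm => [m1 a] [m2 b] um vm; simpl in um, vm; subst m1 m2.
  by rewrite crossE /SHI chain_liftE.
(* An abstract linear map, so that rewriting cannot unfold the quotients. *)
have [f fE] :
    exists f : {linear chains R (prod_sset X X) -> tensor (chains R X) (chains R X)}, forall c, f c = AW_tSHI n (twist c).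
  by exists (AW_tSHI n \o @twist R X : {linear _ -> _}).
rewrite -fE linear_sum; apply: eq_bigr => q _; rewrite linear_sum.
apply: eq_bigr => p _; rewrite linear_sum; apply: eq_bigr => A /eqP cA.
have qm := ltn_ord q; have pm := ltn_ord p.
have tf : tag (SHI_fst m A u) = m.+1 := tag_SHI_fst qm pm cA um.
have tg : tag (SHI_snd m A v) = m.+1 := tag_SHI_snd qm pm cA vm.
by rewrite linearZ fE twist_cross // tf.
Qed.

(** The theorem in terms of blocks; the induction changes the dimension and
    exchanges the two simplices, so all of [m], [u] and [v] vary. *)
Lemma AW_tSHI_blocks n m u v : tag u = m -> tag v = m ->
  AW_tSHI n (cross R u v) =
  increasing_sum n.+1 m.+1 (fun I =>
    (-1) ^+ exponent n m I *: block_tens n m I u v).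
Proof.
elim: n m u v => [|n IH] m.
  case=> m1 a [m2 b] um vm; simpl in um, vm; subst m1 m2.
  rewrite /AW_tSHI [iter _ _ _]/= AW_cross increasing_sum1; apply: eq_bigr => i _.
  have [-> _] := faces_blocks1 i (erefl (tag (Simplex a))).
  have [_ ->] := faces_blocks1 i (erefl (tag (Simplex b))).
  by rewrite /exponent /expA /expB /expC /expD /= !big_geq // scale1r.
move=> u v um vm.
rewrite (AW_tSHI_recl _ um vm) increasing_sumS.
(* No cut precedes a last cut equal to [0]. *)
rewrite big_ord_recl [X in _ = X + _](_ : _ = 0); last by rewrite increasing_sumS big_ord0.
rewrite add0r.
(* After both indices are reversed, [q.+1] is the new last cut and [p], renamed
   [r], the new cut before it. *)
rewrite (reindex_inj rev_ord_inj); apply: eq_bigr => q _.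
have qm := ltn_ord q; rewrite lift0 [nat_of_ord (rev_ord q)]/=.
have -> : (m - (m - q.+1) = q.+1)%N by lia.
rewrite increasing_sumS.
rewrite (reindex_inj rev_ord_inj); apply: eq_bigr => p _; rewrite [nat_of_ord (rev_ord p)]/=.
move: (nat_of_ord p) (ltn_ord p) => r rq.
have mE : m = (r + (q.+1 - r.+1).+1 + (m - q.+1))%N by lia.
have sE : q.+1 = (r + (q.+1 - r.+1).+1)%N by lia.
rewrite [in RHS]sE; exact: (sum_shuffles mE um vm (IH m.+1)).
Qed.

End Step.

Theorem theorem3p1 (R : comPzRingType) (X : sset) (m n : nat) (a b : X m) :
  (~~ odd n ->
     AW_tSHI n (cross R (Simplex a) (Simplex b)) =
     nested_sum n m.+1 (fun I =>
       (-1) ^+ (expA n + expB n m I + expC n I + expD n m I)%N *: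
         tens (cls R (faces (even_fst n m I) (Simplex a)))
              (cls R (faces (even_snd n m I) (Simplex b)))))
  /\
  (odd n ->
     AW_tSHI n (cross R (Simplex a) (Simplex b)) =
     nested_sum n m.+1 (fun I =>
       (-1) ^+ (expA n + expB n m I + expC n I + expD n m I)%N *:
         tens (cls R (faces (odd_fst n m I) (Simplex b)))
              (cls R (faces (odd_snd n m I) (Simplex a))))).
Proof.
have FB (u : simplex X) par I : tag u = m -> size I = n.+1 -> all (gtn m.+1) I ->
    faces (filter (predC (block par I)) (iota 0 m.+1)) u = spanned (blocks par m I) u.
  move=> um sI Im; have [i iI] : exists i, i \in I.
    by case: (I) sI => // i I' _; exists i; exact: mem_head.
  by apply: (faces_blocks _ um iI); have := allP Im i iI.
have am : tag (Simplex a) = m by [].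
have bm : tag (Simplex b) = m by [].
split=> n2; rewrite (AW_tSHI_blocks R n am bm) nested_sumE;
  apply: eq_increasing_sum => I sI lI Im; congr (_ *: _); rewrite /block_tens.
  rewrite (even_fst_gap _ lI sI n2) (even_snd_gap _ lI sI n2) (negPf n2).
  by rewrite (FB _ _ _ am sI Im) (FB _ _ _ bm sI Im).
rewrite (odd_fst_gap _ lI sI n2) (odd_snd_gap _ lI sI n2) n2.
by rewrite (FB _ _ _ am sI Im) (FB _ _ _ bm sI Im).
Qed.
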